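(* Let $p$ be a prime, $q=p^e$, $m\ge1$, and let $C\subseteq\mathbb{F}_{q^m}^n$ be a linear code with a generator matrix $G=(g_{ij})_{i\in[k],\,j\in[n]}$ over $\mathbb{F}_{q^m}$. Let $\mathrm{Tr}_{q^m/q}(C)=\{(\mathrm{Tr}_{q^m/q}(c_1),\dots,\mathrm{Tr}_{q^m/q}(c_n)):(c_1,\dots,c_n)\in C\}$ be its trace code over $\mathbb{F}_q$. Then the $p$-adic valuation of $\mathrm{Tr}_{q^m/q}(C)$ is equal to the minimum, over all $\boldsymbol{r}=(r_1,\dots,r_k)\in[0,q^m-1]^k$ with $|\boldsymbol{r}|=\sum_i r_i\equiv0\pmod{q-1}$ and $|\boldsymbol{r}|>0$, of \[\frac{1}{p-1}\sum_{i=1}^k S_p(r_i)+\nu_p\Big(\sum_{j=1}^n\prod_{i=1}^k T(g_{ij})^{r_i}\Big)-e.\]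
   Context: A linear code over $\mathbb{F}_q$ is $\Delta$-divisible if the Hamming weight of each codeword is divisible by $\Delta$; its $p$-adic valuation is the greatest integer $t$ such that it is $p^t$-divisible. $[a,b]=\{i\in\mathbb{Z}:a\le i\le b\}$, $[k]=[1,k]$. $S_p(a)$ is the sum of the base-$p$ digits of $a$. $T:\mathbb{F}_{q^m}\to\mathbb{Z}_p[\xi_{q^m-1}]$ is the Teichmüller lift: $T(0)=0$ and $T$ maps $\mathbb{F}_{q^m}^\times$ to the $(q^m-1)$-st roots of unity as the inverse of reduction modulo $p$; the convention $T(0)^0=1$ is used. $\nu_p$ is the $p$-adic valuation extended to the relevant cyclotomic extension of $\mathbb{Q}_p$ (with $\nu_p(0)=\infty$). *)

(* Defs.v *)
From Stdlib Require Import ClassicalEpsilon.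
From mathcomp Require Import all_boot all_order all_algebra all_field.

Set Implicit Arguments.
Unset Strict Implicit.
Unset Printing Implicit Defensive.

Import Order.TTheory GRing.Theory Num.Theory.
Local Open Scope ring_scope.

Definition trace (F : finFieldType) (q m : nat) (x : F) : F :=
  \sum_(i < m) x ^+ (q ^ i).

Definition tr_weight (F : finFieldType) (q m n : nat) (c : 'rV[F]_n) : nat :=
  #|[set j : 'I_n | trace q m (c 0 j) != 0]|.

Definition trcode_divisible (F : finFieldType) (k n : nat) (q m : nat)
    (G : 'M[F]_(k, n)) (D : nat) : Prop :=
  forall u : 'rV[F]_k, (D %| tr_weight q m (u *m G))%N.

Definition trcode_pval_is (F : finFieldType) (k n : nat) (p q m : nat)
    (G : 'M[F]_(k, n)) (v : option nat) : Prop :=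
  match v with
  | Some t => trcode_divisible q m G (p ^ t) /\ ~ trcode_divisible q m G (p ^ t.+1)
  | None => forall t, trcode_divisible q m G (p ^ t)
  end.

Definition trcode_pval (F : finFieldType) (k n : nat) (p q m : nat)
    (G : 'M[F]_(k, n)) : option nat :=
  epsilon (inhabits None) (trcode_pval_is p q m G).

(* xi : a primitive N-th root of unity in algC (N = q^m - 1),
   z  : a primitive N-th root of unity in F.  The ring map Z[xi] -> F,
   xi |-> z, is reduction modulo the prime P above p; T is its inverse on
   {0} u mu_N, and nu below is the P-adic valuation (= nu_p on the
   completion Z_p[xi], unramified, so nu(p) = 1). *)

Definition tlift (F : finFieldType) (N : nat) (z : F) (xi : algC) (x : F)
  : algC :=
  if [pick j : 'I_N | z ^+ j == x] is Some j then xi ^+ j else 0.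

Definition intpF (F : finFieldType) (s : {poly int}) : {poly F} :=
  map_poly (fun c : int => c%:~R) s.
Definition intpC (s : {poly int}) : {poly algC} :=
  map_poly (fun c : int => c%:~R) s.

(* nu(a) >= t : there is s in Z[xi] \ P with s * a in p^t Z[xi] *)
Definition nu_ge (F : finFieldType) (p : nat) (z : F) (xi : algC)
    (t : nat) (a : algC) : Prop :=
  exists s b : {poly int},
    (intpF F s).[z] != 0 /\ (intpC s).[xi] * a = (p ^ t)%:R * (intpC b).[xi].

Definition nu_is (F : finFieldType) (p : nat) (z : F) (xi : algC)
    (a : algC) (v : option nat) : Prop :=
  match v with
  | Some t => nu_ge p z xi t a /\ ~ nu_ge p z xi t.+1 a
  | None => forall t, nu_ge p z xi t a
  end.

Definition nu (F : finFieldType) (p : nat) (z : F) (xi : algC) (a : algC)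
  : option nat :=
  epsilon (inhabits None) (nu_is p z xi a).

Fixpoint digsum_fuel (f p a : nat) : nat :=
  match f with
  | 0 => 0
  | f'.+1 => if a == 0%N then 0 else (a %% p + digsum_fuel f' p (a %/ p))%N
  end.
Definition digsum (p a : nat) : nat := digsum_fuel a.+1 p a.

Definition omin (x y : option rat) : option rat :=
  match x, y with
  | None, _ => y
  | _, None => x
  | Some a, Some b => Some (Num.min a b)
  end.

(* Main.v *)
(* Let Psi = zeta ^ Tr be the additive character of the field, zeta a primitive
   p-th root of unity, N = q^m - 1, and N Psi(x) = sum_{r <= N} c_r T(x)^r.
   Counting the zeros of the trace by means of Psi gives
     - N^k q wt(u) = (q - 1) sum_r (prod_i c_{r_i}) M_r T(u)^r,
   where r runs over the exponents of the theorem and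
   M_r = sum_j prod_i T(g_ij)^{r_i}.  The Vandermonde matrix of the Teichmueller
   points is invertible at the given prime, so a power of pi = 1 - zeta divides
   all q wt(u) iff it divides all coefficients, and c_r has pi-adic valuation
   S_p(r) (Stickelberger).  Writing v(r) for the latter valuation, this follows
   from v(r) + v(N - r) = v(q^m) and v(r) <= S_p(r); the bound holds because
   v(1) = 1, v(p r) = v(r), and v is subadditive thanks to Jacobi sums. *)
Require Import Defs.
From Stdlib Require Import ClassicalEpsilon.
From mathcomp Require Import all_boot all_order all_algebra all_field.
From mathcomp Require Import ring zify.
Import Order.TTheory GRing.Theory Num.Theory.
Local Open Scope ring_scope.

Set Implicit Arguments.
Unset Strict Implicit.
Unset Printing Implicit Defensive.

(** * Reduction and valuation without localization *)

(** Everything happens in the subring Z[w] of [algC], w = zeta xi, with no completion and no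
    localization: an element is the value f(w) of an integer polynomial f and its reduction is f(z).
    This is sound because the cyclotomic polynomial of order pN vanishes at z modulo p. It behaves
    like a discrete valuation ring because, up to factors of nonzero reduction, p generates the
    kernel of reduction in Z[xi], and pi does so in Z[w]. The constants of the formula come from p ~
    pi^(p-1): dividing pi-adic valuations by p - 1 gives the factor 1/(p-1), and the q beside the
    weight gives -e. Inverting the Vandermonde matrix costs only factors N, which are units at the
    prime, so N is kept as a multiplier throughout. Both 0 and N must occur as exponents, since x^0
    and x^N differ at x = 0. Valuations may be infinite, for instance when M_r = 0; the two sides of
    the theorem are therefore compared through the integers t that they bound from above. *)

Section Reduction.
Variables (F : finFieldType) (w : algC) (z : F).

(** A relation and not a map, because a can be f(w) for many f; it becomes functional under the
    hypothesis [wd] below. It serves for two pairs with the same z: w = xi and w = zeta xi. *)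
Definition red (a : algC) (y : F) : Prop :=
  exists f : {poly int}, a = (intpC f).[w] /\ y = (intpF F f).[z].

Lemma intpCD f g : intpC (f + g) = intpC f + intpC g.
Proof. exact: (rmorphD (map_poly intr)). Qed.
Lemma intpCM f g : intpC (f * g) = intpC f * intpC g.
Proof. exact: (rmorphM (map_poly intr)). Qed.
Lemma intpFD f g : intpF F (f + g) = intpF F f + intpF F g.
Proof. exact: (rmorphD (map_poly intr)). Qed.
Lemma intpFM f g : intpF F (f * g) = intpF F f * intpF F g.
Proof. exact: (rmorphM (map_poly intr)). Qed.
Lemma intpC_const c : intpC c%:P = (c%:~R)%:P.
Proof. exact: (map_polyC intr). Qed.
Lemma intpF_const c : intpF F c%:P = (c%:~R)%:P.
Proof. exact: (map_polyC intr). Qed.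

Lemma red_int (c : int) : red c%:~R c%:~R.
Proof. by exists c%:P; rewrite intpC_const intpF_const !hornerC. Qed.

Lemma red_nat (n : nat) : red n%:R n%:R.
Proof. exact: (red_int n%:Z). Qed.

Lemma red0 : red 0 0. Proof. exact: (red_nat 0). Qed.
Lemma red1 : red 1 1. Proof. exact: (red_nat 1). Qed.

Lemma red_gen : red w z.
Proof.
exists 'X; rewrite /intpC /intpF (map_polyX intr) (map_polyX intr).
by rewrite !hornerX.
Qed.

Lemma redD a b x y : red a x -> red b y -> red (a + b) (x + y).
Proof.
by move=> [f [-> ->]] [g [-> ->]]; exists (f + g); rewrite intpCD intpFD !hornerD.
Qed.

Lemma redM a b x y : red a x -> red b y -> red (a * b) (x * y).
Proof.
by move=> [f [-> ->]] [g [-> ->]]; exists (f * g); rewrite intpCM intpFM !hornerM.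
Qed.

Lemma redN a x : red a x -> red (- a) (- x).
Proof. by rewrite -!(mulN1r a, mulN1r x); apply: redM (red_int (-1)). Qed.

Lemma redB a b x y : red a x -> red b y -> red (a - b) (x - y).
Proof. by move=> ha hb; apply: redD ha (redN hb). Qed.

Lemma redX a x n : red a x -> red (a ^+ n) (x ^+ n).
Proof.
by move=> h; elim: n => [|n IH]; rewrite ?exprS; [exact: red1 | exact: redM].
Qed.

Lemma red_sum I (s : seq I) (P : pred I) a x :
  (forall i, P i -> red (a i) (x i)) ->
  red (\sum_(i <- s | P i) a i) (\sum_(i <- s | P i) x i).
Proof. by move=> h; apply: (big_ind2 red) => //; [exact: red0 | move=> *; exact: redD]. Qed.

Definition integral a := exists y, red a y.

Lemma integral_sum I (s : seq I) (P : pred I) a :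
  (forall i, P i -> integral (a i)) -> integral (\sum_(i <- s | P i) a i).
Proof.
move=> h; apply: big_ind => //; first by exists 0; exact: red0.
by move=> x y [x' hx] [y' hy]; exists (x' + y'); apply: redD.
Qed.

Lemma integral_prod I (s : seq I) (P : pred I) a :
  (forall i, P i -> integral (a i)) -> integral (\prod_(i <- s | P i) a i).
Proof.
move=> h; apply: big_ind => //; first by exists 1; exact: red1.
by move=> x y [x' hx] [y' hy]; exists (x' * y'); apply: redM.
Qed.

Lemma integralM a b : integral a -> integral b -> integral (a * b).
Proof. by move=> [x hx] [y hy]; exists (x * y); apply: redM. Qed.

(* Valuations are expressed without localizing: [vge pi t a] says that
   [pi ^ t] divides [a] up to a factor with nonzero reduction, [vex] that the
   cofactor has moreover nonzero reduction. *)
Definition vge (pi : algC) (t : nat) (a : algC) : Prop :=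
  exists s b y y', [/\ red s y, y != 0, red b y' & s * a = pi ^+ t * b].

Definition vex (pi : algC) (t : nat) (a : algC) : Prop :=
  exists s b y y', [/\ red s y, y != 0, red b y' & y' != 0 /\ s * a = pi ^+ t * b].

Lemma vex_vge pi t a : vex pi t a -> vge pi t a.
Proof. by move=> [s [b [y [y' [? ? ? [? ?]]]]]]; exists s, b, y, y'. Qed.

Lemma vex0 pi a y : red a y -> y != 0 -> vex pi 0 a.
Proof.
move=> ha y0; exists 1, a, 1, y.
split; [exact: red1|exact: oner_neq0|exact: ha|split=> //].
Qed.

Lemma vge_integral pi a : integral a -> vge pi 0 a.
Proof.
move=> [y ha]; exists 1, a, 1, y.
split; [exact: red1|exact: oner_neq0|exact: ha|].
by rewrite expr0.
Qed.

Lemma vge_zero pi t : vge pi t 0.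
Proof.
exists 1, 0, 1, 0; split; [exact: red1|exact: oner_neq0|exact: red0|].
by rewrite !mulr0.
Qed.

Lemma vexM pi t t' a a' : vex pi t a -> vex pi t' a' -> vex pi (t + t') (a * a').
Proof.
move=> [s [b [x [y [hs x0 hb [y0 e]]]]]] [s' [b' [x' [y' [hs' x0' hb' [y0' e']]]]]].
exists (s * s'), (b * b'), (x * x'), (y * y').
split; [exact: redM|by rewrite mulf_neq0|exact: redM|split].
  by rewrite mulf_neq0.
by rewrite exprD mulrACA e e' mulrACA.
Qed.

Lemma vgeM pi t t' a a' : vge pi t a -> vge pi t' a' -> vge pi (t + t') (a * a').
Proof.
move=> [s [b [x [y [hs x0 hb e]]]]] [s' [b' [x' [y' [hs' x0' hb' e']]]]].
exists (s * s'), (b * b'), (x * x'), (y * y').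
split; [exact: redM|by rewrite mulf_neq0|exact: redM|].
by rewrite exprD mulrACA e e' mulrACA.
Qed.

Lemma vex_prod pi (I : eqType) (s : seq I) (t : I -> nat) (a : I -> algC) :
  (forall i, i \in s -> vex pi (t i) (a i)) ->
  vex pi (\sum_(i <- s) t i) (\prod_(i <- s) a i).
Proof.
move=> h; rewrite big_seq [X in vex _ _ X]big_seq.
elim/big_ind2: _ => //; first by apply: vex0 red1 (oner_neq0 _).
by move=> ? ? ? ?; apply: vexM.
Qed.

Lemma vexX pi t a n : vex pi t a -> vex pi (t * n) (a ^+ n).
Proof.
move=> h; elim: n => [|n IH]; last by rewrite exprS mulnS; apply: vexM.
by rewrite muln0 expr0; apply: vex0 red1 (oner_neq0 _).
Qed.

Lemma vgeD pi t a a' : vge pi t a -> vge pi t a' -> vge pi t (a + a').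
Proof.
move=> [s [b [x [y [hs x0 hb e]]]]] [s' [b' [x' [y' [hs' x0' hb' e']]]]].
exists (s * s'), (b * s' + s * b'), (x * x'), (y * x' + x * y').
split; [exact: redM|by rewrite mulf_neq0|apply: redD; exact: redM|].
move: (pi ^+ t) e e' => P e e'; ring: e e'.
Qed.

Lemma vge_sum pi t I (s : seq I) (P : pred I) (a : I -> algC) :
  (forall i, P i -> vge pi t (a i)) -> vge pi t (\sum_(i <- s | P i) a i).
Proof. by move=> h; apply: big_ind => //; [exact: vge_zero | exact: vgeD]. Qed.

(** Change of base: as p has exact valuation p - 1 at pi, powers of p turn into powers of pi. *)
Lemma vge_trans pi pi' d t a :
  vge pi d pi' -> vge pi' t a -> vge pi (d * t) a.
Proof.
move=> [s [b [x [y [hs x0 hb e]]]]] [s' [b' [x' [y' [hs' x0' hb' e']]]]].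
exists (s ^+ t * s'), (b ^+ t * b'), (x ^+ t * x'), (y ^+ t * y').
split; [by apply: redM => //; apply: redX|by rewrite mulf_neq0 ?expf_neq0|
  by apply: redM => //; apply: redX|].
by rewrite -mulrA e' mulrA -exprMn e exprMn exprM mulrA.
Qed.

Lemma vex_trans pi pi' d t a :
  vex pi d pi' -> vex pi' t a -> vex pi (d * t) a.
Proof.
move=> [s [b [x [y [hs x0 hb [y0 e]]]]]] [s' [b' [x' [y' [hs' x0' hb' [y0' e']]]]]].
exists (s ^+ t * s'), (b ^+ t * b'), (x ^+ t * x'), (y ^+ t * y').
split; [by apply: redM => //; apply: redX|by rewrite mulf_neq0 ?expf_neq0|
  by apply: redM => //; apply: redX|split].
  by rewrite mulf_neq0 ?expf_neq0.
by rewrite -mulrA e' mulrA -exprMn e exprMn exprM mulrA.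
Qed.

Lemma vge_leq pi x t t' a : red pi x -> (t <= t')%N -> vge pi t' a -> vge pi t a.
Proof.
move=> hpi /subnK <- [s [b [y [y' [hs x0 hb e]]]]].
exists s, (pi ^+ (t' - t) * b), y, (x ^+ (t' - t) * y'); split=> //.
  by apply: redM => //; apply: redX.
by rewrite e addnC exprD -mulrA.
Qed.

(** Division by an element of known exact valuation; it later removes q, q - 1 and N^k. *)
Lemma vge_cancel pi t n c a : pi != 0 -> vex pi t c -> vge pi (t + n) (c * a) -> vge pi n a.
Proof.
move=> pi0 [s [b [x [y [hs x0 hb [y0 e]]]]]] [s' [b' [x' [y' [hs' x0' hb' e']]]]].
exists (s' * b), (s * b'), (x' * y), (x * y').
split; [exact: redM|by rewrite mulf_neq0|exact: redM|].
apply: (mulfI (expf_neq0 t pi0)).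
have -> : pi ^+ t * (s' * b * a) = s' * a * (pi ^+ t * b) by ring.
have -> : pi ^+ t * (pi ^+ n * (s * b')) = s * (pi ^+ (t + n) * b').
  by rewrite exprD; ring.
by rewrite -e -e'; ring.
Qed.

(** * Uniqueness of reductions and existence of exact valuations *)

Section Unique.
Hypothesis wd : forall f : {poly int}, (intpC f).[w] = 0 -> (intpF F f).[z] = 0.

Lemma red_fun a x y : red a x -> red a y -> x = y.
Proof.
move=> [f [-> ->]] [g [e ->]]; apply/eqP; rewrite -subr_eq0; apply/eqP.
rewrite -hornerN -hornerD -[- intpF F g]mulN1r.
have -> : (-1 : {poly F}) = intpF F (-1)%:P by rewrite intpF_const polyCN.
rewrite -intpFM -intpFD; apply: wd; rewrite intpCD hornerD e intpCM hornerM.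
by rewrite intpC_const hornerC mulN1r subrr.
Qed.

(** If t < t', cancelling pi^t equates [s' * b], of nonzero reduction, with a multiple of pi. *)
Lemma vex_max pi t t' a : pi != 0 -> red pi 0 -> vex pi t a -> vge pi t' a -> (t' <= t)%N.
Proof.
move=> pi0 hpi [s [b [x [y [hs x0 hb [y0 e]]]]]] [s' [b' [x' [y' [hs' x0' hb' e']]]]].
rewrite leqNgt; apply/negP => lt.
have eq1 : s' * b = pi * (pi ^+ (t' - t.+1) * (s * b')).
  apply: (mulfI (expf_neq0 t pi0)).
  have -> : pi ^+ t * (pi * (pi ^+ (t' - t.+1) * (s * b'))) = s * (pi ^+ t' * b').
    by rewrite -{2}(subnKC lt) exprD exprS; ring.
  by rewrite -e' mulrCA -e; ring.
have h1 : red (s' * b) (x' * y) by apply: redM.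
have h2 : red (s' * b) (0 * (0 ^+ (t' - t.+1) * (x * y'))).
  rewrite eq1; do ![apply: redM => //]; exact: redX.
by move: (red_fun h1 h2) => /eqP; rewrite mul0r mulf_eq0 (negPf x0') (negPf y0).
Qed.

(** Exact valuations of factors are not given in advance; they are extracted from that of the
    product. If a has nonzero reduction, its valuation is 0; otherwise [loc] splits off one factor
    pi and n drops by one. *)
Lemma vex_split pi n a a' :
  pi != 0 -> red pi 0 -> (forall b, red b 0 -> vge pi 1 b) ->
  integral a -> integral a' -> vex pi n (a * a') ->
  exists t t', [/\ vex pi t a, vex pi t' a' & (t + t' = n)%N].
Proof.
move=> pi0 hpi loc; elim: n a => [|n IH] a [x ha] ha' h.
  have [y ha1] := ha'.
  have [s [b [v [v' [hs v0 hb [v0' e]]]]]] := h.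
  have := red_fun (redM hs (redM ha ha1)) (a := s * (a * a')).
  rewrite e expr0 mul1r => /(_ _ hb) ee.
  have: v * (x * y) != 0 by rewrite ee.
  rewrite !mulf_eq0 !negb_or => /and3P [_ x0 y0].
  by exists 0%N, 0%N; split; [apply: vex0 ha x0|apply: vex0 ha1 y0|].
have [x0|x0] := eqVneq x 0; last first.
  exists 0%N, n.+1; split=> //; first exact: vex0 ha x0.
  have [s [b [v [v' [hs v0 hb [v0' e]]]]]] := h.
  by exists (s * a), b, (v * x), v'; split;
    [exact: redM|rewrite mulf_neq0|exact: hb|split; rewrite // -mulrA].
rewrite x0 in ha; have [s [b [v [v' [hs v0 hb e]]]]] := loc _ ha.
have hba : vex pi n (b * a').
  have [s1 [b1 [v1 [v1' [hs1 v10 hb1 [v10' e1]]]]]] := h.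
  exists s1, (s * b1), v1, (v * v1'); split=> //; first exact: redM.
  split; first by rewrite mulf_neq0.
  apply: (mulfI pi0); rewrite expr1 in e.
  have -> : pi * (s1 * (b * a')) = s1 * ((pi * b) * a') by ring.
  have -> : pi * (pi ^+ n * (s * b1)) = s * (pi ^+ n.+1 * b1) by rewrite exprS; ring.
  by rewrite -e -e1; ring.
have [t [t' [h1 h2 h3]]] := IH b (ex_intro _ _ hb) ha' hba.
exists t.+1, t'; split=> //; last by rewrite addSn h3.
have [s1 [b1 [v1 [v1' [hs1 v10 hb1 [v10' e1]]]]]] := h1.
exists (s1 * s), b1, (v1 * v), v1'; split=> //; [exact: redM|by rewrite mulf_neq0|].
by split=> //; rewrite -mulrA e expr1 mulrCA e1 exprS mulrA.
Qed.

End Unique.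
End Reduction.

(** * The prime of Z[xi] is unramified *)

(** Division by a monic polynomial stays over the integers, and the remainder vanishes at w while
    having smaller degree than the minimal polynomial of w over the rationals. *)
Lemma Cyclotomic_dvd n (w : algC) (f : {poly int}) :
  n.-primitive_root w -> (intpC f).[w] = 0 -> exists g, f = g * 'Phi_n.
Proof.
move=> pw fw.
have mon := Cyclotomic_monic n.
exists (Pdiv.Ring.rdivp f 'Phi_n).
rewrite {1}(Pdiv.RingMonic.rdivp_eq mon f).
set r := Pdiv.Ring.rmodp _ _.
suff -> : r = 0 by rewrite addr0.
have szr : (size r < size 'Phi_n)%N.
  by apply: Pdiv.Ring.ltn_rmodpN0; exact: monic_neq0.
have rw : root (map_poly intr r : {poly algC}) w.
  move: fw; rewrite (Pdiv.RingMonic.rdivp_eq mon f) intpCD hornerD intpCM hornerM.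
  have -> : (intpC 'Phi_n).[w] = 0.
    apply/eqP; rewrite -/(root _ _) (Cintr_Cyclotomic pw : intpC _ = _).
    by rewrite root_cyclotomic.
  by rewrite mulr0 add0r => /eqP.
have [q [Dq monq dvdq]] := minCpolyP w.
have rq : map_poly intr r = map_poly (ratr : rat -> algC) (map_poly intr r).
  rewrite -map_poly_comp; apply: eq_map_poly => c /=; by rewrite ratr_int.
apply/eqP; apply: contraTT szr => r0; rewrite -leqNgt.
move: rw; rewrite rq dvdq => /dvdp_leq; rewrite map_poly_eq0_id0; last first.
  by rewrite intr_eq0 lead_coef_eq0.
move=> /(_ r0); rewrite size_map_inj_poly //; last exact: intr_inj.
apply: leq_trans; rewrite -(size_map_poly (ratr : {rmorphism rat -> algC})) -Dq.
by rewrite (minCpoly_cyclotomic pw) size_cyclotomic size_Cyclotomic.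
Qed.

Section ResidueField.
Variables (p N : nat) (F : finFieldType) (z : F).
Hypotheses (p_pr : prime p) (pF : p \in [pchar F]) (zP : N.-primitive_root z).

Lemma intpF_Xn1 n : intpF F ('X^n - 1) = 'X^n - 1.
Proof. by rewrite /intpF rmorphB /= (map_polyXn intr) rmorph1. Qed.

Lemma root_Cyclotomic_expr1 d (x : F) :
  (0 < d)%N -> root (intpF F 'Phi_d) x -> x ^+ d = 1.
Proof.
move=> d0 rx; apply/eqP; rewrite -subr_eq0; apply/eqP.
have -> : x ^+ d - 1 = ('X^d - 1).[x] by rewrite !hornerE.
rewrite -intpF_Xn1 -(prod_Cyclotomic d0) /intpF rmorph_prod /=.
rewrite horner_prod.
rewrite (big_rem d) /= ?(eqP rx) ?mul0r //.
by rewrite -dvdn_divisors.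
Qed.

(** Removing Phi_N from X^(pN) - 1 = (X^N - 1)^p leaves a factor X^N - 1, because p > 1. So z is a
    root of another Phi_d with d | pN, and z^d = 1 forces N | d, hence d = pN. *)
Lemma root_Cyclotomic_mul_char : root (intpF F 'Phi_(p * N)) z.
Proof.
have N0 := prim_order_gt0 zP; have p0 := prime_gt0 p_pr.
have pN0 : (0 < p * N)%N by rewrite muln_gt0 p0.
pose P d := intpF F 'Phi_d.
pose R := \prod_(d <- rem N (divisors (p * N))) P d.
pose R' := \prod_(d <- rem N (divisors N)) P d.
have Pprod n : (0 < n)%N -> \prod_(d <- divisors n) P d = 'X^n - 1.
  by move=> n0; rewrite -intpF_Xn1 -(prod_Cyclotomic n0) /intpF rmorph_prod.
have eR : P N * R = 'X^(p * N) - 1.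
  by rewrite -Pprod // [RHS](big_rem N) //= -dvdn_divisors // dvdn_mull.
have eR' : P N * R' = 'X^N - 1.
  by rewrite -Pprod // [RHS](big_rem N) //= -dvdn_divisors.
have frob : 'X^(p * N) - 1 = ('X^N - 1) ^+ p :> {poly F}.
  have pP : p \in [pchar {poly F}] by rewrite pchar_poly.
  by rewrite -(pFrobenius_autE pP) rmorphB rmorph1 /= pFrobenius_autE -exprM mulnC.
have PN0 : P N != 0.
  by apply: contra_eq_neq eR' => ->; rewrite mul0r eq_sym monic_neq0 // monicXnsubC.
have : R.[z] = 0.
  have -> : R = ('X^N - 1) ^+ p.-1 * R'.
    apply: (mulfI PN0); rewrite eR frob -{1}(prednK p0) exprS -{1}eR'.
    ring.
  rewrite hornerM horner_exp !hornerE (prim_expr_order zP) subrr.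
  by rewrite expr0n; case: (p) (prime_gt1 p_pr) => [|[|]] //= ?; rewrite mul0r.
move=> /eqP; rewrite /R horner_prod prodf_seq_eq0 => /hasP [d].
rewrite mem_rem_uniq ?divisors_uniq // inE -dvdn_divisors // => /andP [dN dpN] /= rd.
have d0 : (0 < d)%N by apply: dvdn_gt0 dpN.
have zd := root_Cyclotomic_expr1 d0 rd.
have /dvdnP [c ec] : (N %| d)%N by rewrite (prim_order_dvd zP) zd.
move: dpN dN; rewrite {1}ec dvdn_pmul2r // => cp.
case/primeP: p_pr => _ /(_ c cp) /orP [] /eqP c1; first by rewrite ec c1 mul1n eqxx.
by move=> _; rewrite -c1 -ec.
Qed.

Lemma cyclotomic_reduction (w : algC) (f : {poly int}) :
  (p * N).-primitive_root w -> (intpC f).[w] = 0 -> (intpF F f).[z] = 0.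
Proof.
move=> pw /(Cyclotomic_dvd pw) [g ->]; rewrite intpFM hornerM.
by rewrite (eqP root_Cyclotomic_mul_char) mulr0.
Qed.

Lemma prime_field_embedding : exists iota : {rmorphism 'F_p -> F}, True.
Proof.
pose j : {rmorphism 'F_p -> pPrimeCharType pF} := GRing.in_alg (pPrimeCharType pF).
by exists (j : {rmorphism 'F_p -> F}).
Qed.

(** If N = cp, then (z^c)^p = 1, and injectivity of Frobenius gives z^c = 1 with c < N. *)
Lemma prim_order_natr_neq0 : N%:R != 0 :> F.
Proof.
have N0 := prim_order_gt0 zP.
apply/negP; rewrite -(dvdn_pcharf pF) => /dvdnP [c ec].
have c0 : (0 < c)%N by move: N0; rewrite ec; case: (c).
have zc : z ^+ c = 1.
  apply: (fmorph_inj (pFrobenius_aut pF)); rewrite rmorph1 /= pFrobenius_autE -exprM.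
  by rewrite -ec (prim_expr_order zP).
move: (prim_order_dvd zP c); rewrite zc eqxx => /(dvdn_leq c0).
by rewrite leqNgt ec ltn_Pmulr // prime_gt1.
Qed.

(* [s * f] is divisible by [X^N - 1] modulo [p] for [s] the cofactor of
   [gcd(f, X^N - 1)], and [z] is a simple root of [X^N - 1]. *)
Lemma unramified (xi : algC) a :
  N.-primitive_root xi -> red xi z a 0 -> vge xi z p%:R 1 a.
Proof.
move=> xiP [f [-> fz]].
have [iota _] := prime_field_embedding.
pose Rd : {poly int} -> {poly 'F_p} := map_poly intr.
pose L : {poly 'F_p} -> {poly int} := map_poly (fun x : 'F_p => (x : nat)%:Z).
have RdL g : Rd (L g) = g.
  rewrite /Rd /L -map_poly_comp_id0 //; apply: map_poly_id => c _ /=.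
  exact: natr_Zp.
have RdF g : map_poly iota (Rd g) = intpF F g.
  rewrite -map_poly_comp; apply: eq_map_poly => c /=; exact: rmorph_int.
pose d := gcdp (Rd f) ('X^N - 1).
have /dvdpP [s es] : d %| 'X^N - 1 by exact: dvdp_gcdr.
have /dvdpP [g eg] : d %| Rd f by exact: dvdp_gcdl.
have Rd0 : Rd (L s * f - ('X^N - 1) * L g) = 0.
  rewrite /Rd rmorphB !rmorphM rmorphB /= (map_polyXn intr) rmorph1.
  rewrite -/(Rd f) -/(Rd (L s)) -/(Rd (L g)) !RdL es {1}eg; ring.
have [b eb] : exists b, L s * f - ('X^N - 1) * L g = p%:Z%:P * b.
  set q := _ - _ in Rd0 *.
  exists (map_poly (fun c => (c %/ p)%Z) q); apply/polyP => i.
  rewrite coefCM coef_map_id0 ?div0z // mulrC divzK //.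
  rewrite (dvdz_pcharf (pchar_Fp p_pr)) -(coef_map intr) -/(Rd q) Rd0.
  by rewrite coef0.
have sz : (intpF F (L s)).[z] != 0.
  rewrite -RdF RdL; apply/negP => /eqP s0.
  have d0 : (map_poly iota d).[z] = 0.
    apply/eqP; rewrite -/(root _ z) /d gcdp_map root_gcd RdF.
    rewrite rmorphB /= map_polyXn rmorph1 /root -fz eqxx /=.
    by rewrite !hornerE (prim_expr_order zP) subrr.
  have : ('X^N - 1 : {poly F})^`().[z] = 0.
    have -> : ('X^N - 1 : {poly F}) = map_poly iota s * map_poly iota d.
      by rewrite -rmorphM -es rmorphB /= map_polyXn rmorph1.
    by rewrite derivM hornerD !hornerM s0 d0 mulr0 mul0r addr0.
  rewrite derivB derivXn derivC subr0 hornerMn hornerXn -mulr_natr => /eqP.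
  rewrite mulf_eq0 (negPf prim_order_natr_neq0) orbF expf_eq0 => /andP [_ z0].
  move: (prim_expr_order zP); rewrite (eqP z0) expr0n (gtn_eqF (prim_order_gt0 zP)).
  by move=> /eqP; rewrite eq_sym oner_eq0.
exists (intpC (L s)).[xi], (intpC b).[xi], (intpF F (L s)).[z], (intpF F b).[z].
split=> //; [by exists (L s)|by exists b|].
rewrite -hornerM -intpCM expr1.
have -> : L s * f = p%:Z%:P * b + ('X^N - 1) * L g by rewrite -eb subrK.
rewrite intpCD hornerD !intpCM !hornerM intpC_const hornerC.
rewrite {2}/intpC rmorphB /= (map_polyXn intr) rmorph1 !hornerE.
by rewrite (prim_expr_order xiP) subrr mul0r addr0.
Qed.

End ResidueField.

(** * The totally ramified extension Z[xi, zeta] *)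

Lemma prim_rootM (K : fieldType) (a b : nat) (x y : K) :
  coprime a b -> a.-primitive_root x -> b.-primitive_root y ->
  (a * b).-primitive_root (x * y).
Proof.
move=> co px py.
have a0 := prim_order_gt0 px; have b0 := prim_order_gt0 py.
have e1 : (x * y) ^+ (a * b) = 1.
  by rewrite exprMn {1}exprM (prim_expr_order px) mulnC exprM
     (prim_expr_order py) !expr1n mulr1.
have ab0 : (0 < a * b)%N by rewrite muln_gt0 a0.
have [d pd dab] := prim_order_exists ab0 e1.
have e2 : (x * y) ^+ d = 1 := prim_expr_order pd.
have da : (a %| d)%N.
  rewrite -(Gauss_dvdl _ co) (prim_order_dvd px).
  move: (congr1 (fun t => t ^+ b) e2); rewrite expr1n -exprM exprMn.
  by rewrite [y ^+ _]exprM exprAC (prim_expr_order py) expr1n mulr1 => ->.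
have db : (b %| d)%N.
  rewrite coprime_sym in co.
  rewrite -(Gauss_dvdl _ co) (prim_order_dvd py).
  move: (congr1 (fun t => t ^+ a) e2); rewrite expr1n -exprM exprMn.
  by rewrite [x ^+ _]exprM exprAC (prim_expr_order px) expr1n mul1r => ->.
have <- : d = (a * b)%N by apply/eqP; rewrite eqn_dvd dab Gauss_dvd // da.
exact: pd.
Qed.

Lemma horner_intr (A : nzRingType) (f : {poly int}) (x : A) :
  (map_poly intr f).[x] = \sum_(i < size f) (f`_i)%:~R * x ^+ i.
Proof.
rewrite (horner_coef_wide (n := size f)) ?size_poly //.
by apply: eq_bigr => i _; rewrite coef_map.
Qed.

(** Both sides are the value at 1 of (X^p - 1)/(X - 1). *)
Lemma prod_1_sub_prim (p : nat) (zeta : algC) : (0 < p)%N ->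
  p.-primitive_root zeta -> \prod_(1 <= i < p) (1 - zeta ^+ i) = p%:R.
Proof.
move=> p0 zP.
have e : \prod_(1 <= i < p) ('X - (zeta ^+ i)%:P) = \sum_(i < p) 'X^i :> {poly algC}.
  apply: (mulfI (negbT (polyXsubC_eq0 (1 : algC)))).
  by rewrite -(subrX1 'X p) -(factor_Xn_sub_1 zP) [RHS]big_ltn // expr0.
move: (congr1 (fun q => q.[1]) e); rewrite horner_prod horner_sum.
rewrite (eq_bigr (fun i => 1 - zeta ^+ i)) => [->|i _]; last by rewrite !hornerE.
rewrite (eq_bigr (fun _ => 1)) => [|i _]; last by rewrite hornerXn expr1n.
by rewrite sumr_const card_ord.
Qed.

Section Ramified.
Variables (p N : nat) (F : finFieldType) (z : F) (xi zeta : algC).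
Hypotheses (p_pr : prime p) (pF : p \in [pchar F]) (zP : N.-primitive_root z).
Hypotheses (xiP : N.-primitive_root xi) (zetaP : p.-primitive_root zeta).

(** A single generator of Z[xi, zeta], so that [red] applies to this ring as well. *)
Let w := zeta * xi.
Let pi := 1 - zeta.

Lemma coprime_char_order : coprime p N.
Proof. by rewrite prime_coprime // (dvdn_pcharf pF) (prim_order_natr_neq0 p_pr pF zP). Qed.

Lemma omega_prim : (p * N).-primitive_root w.
Proof. exact: prim_rootM coprime_char_order zetaP xiP. Qed.

Lemma omega_wd (f : {poly int}) : (intpC f).[w] = 0 -> (intpF F f).[z] = 0.
Proof. exact: (cyclotomic_reduction p_pr pF zP omega_prim). Qed.

(** By the Chinese remainder theorem xi is the power w^a with a = 0 mod p and a = 1 mod N, and z^a =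
    z. Exchanging the two residues gives zeta, which therefore reduces to 1. *)
Lemma red_omega_xi : red w z xi z.
Proof.
have co := coprime_char_order.
pose a := chinese p N 0 1.
have ap : (a = 0 %[mod p])%N by exact: chinese_modl.
have aN : (a = 1 %[mod N])%N by exact: chinese_modr.
have := redX a (red_gen w z).
rewrite /w exprMn -(prim_expr_mod zetaP) ap (prim_expr_mod zetaP) expr0 mul1r.
rewrite -(prim_expr_mod xiP) aN (prim_expr_mod xiP) expr1.
by rewrite -(prim_expr_mod zP) aN (prim_expr_mod zP) expr1.
Qed.

Lemma red_omega_zeta : red w z zeta 1.
Proof.
have co := coprime_char_order.
pose a := chinese p N 1 0.
have ap : (a = 1 %[mod p])%N by exact: chinese_modl.
have aN : (a = 0 %[mod N])%N by exact: chinese_modr.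
have := redX a (red_gen w z).
rewrite /w exprMn -(prim_expr_mod zetaP) ap (prim_expr_mod zetaP) expr1.
rewrite -(prim_expr_mod xiP) aN (prim_expr_mod xiP) expr0 mulr1.
by rewrite -(prim_expr_mod zP) aN (prim_expr_mod zP) expr0.
Qed.

Lemma red_omega_pi : red w z pi 0.
Proof. by rewrite -(subrr 1); apply: redB (red1 _ _) red_omega_zeta. Qed.

Lemma pi_neq0 : pi != 0.
Proof.
rewrite subr_eq0 eq_sym; apply/negP => /eqP z1.
have := prim_order_dvd zetaP 1; rewrite z1 expr1 eqxx dvdn1.
by case: (p) (prime_gt1 p_pr) => [|[|]].
Qed.

Lemma red_omega a y : red xi z a y -> red w z a y.
Proof.
move=> [f [-> ->]]; rewrite /intpC /intpF !horner_intr.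
apply: red_sum => i _; apply: redM; first exact: red_int.
by apply: redX; exact: red_omega_xi.
Qed.

Lemma vge_omega q t a : vge xi z q t a -> vge w z q t a.
Proof.
move=> [s [b [y [y' [hs y0 hb e]]]]]; exists s, b, y, y'.
by split=> //; exact: red_omega.
Qed.

Lemma vex_omega q t a : vex xi z q t a -> vex w z q t a.
Proof.
move=> [s [b [y [y' [hs y0 hb e]]]]]; exists s, b, y, y'.
by split=> //; exact: red_omega.
Qed.

(** Total ramification: p is the product of the 1 - zeta^i, and each is pi times 1 + ... +
    zeta^(i-1), whose reduction i is nonzero. *)
Lemma vex_p : vex w z pi p.-1 p%:R.
Proof.
rewrite -(prod_1_sub_prim (prime_gt0 p_pr) zetaP).
have -> : p.-1 = (\sum_(1 <= i < p) 1)%N by rewrite sum_nat_const_nat muln1 subn1.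
apply: vex_prod => i; rewrite mem_index_iota => /andP [i0 ip].
have -> : 1 - zeta ^+ i = pi * \sum_(j < i) zeta ^+ j.
  by rewrite -[LHS]opprB subrX1 -mulNr opprB.
exists 1, (\sum_(j < i) zeta ^+ j), 1, i%:R; split.
- exact: red1.
- exact: oner_neq0.
- rewrite -[i in i%:R](card_ord i) -sumr_const; apply: red_sum => j _.
  by rewrite -(expr1n F j); apply: redX red_omega_zeta.
split; last by rewrite mul1r expr1.
apply/negP; rewrite -(dvdn_pcharf pF) => /(dvdn_leq i0).
by rewrite leqNgt ip.
Qed.

(** Modulo pi the value f(zeta xi) agrees with f(xi), and the latter is locally divisible by p,
    hence by pi. *)
Lemma omega_loc a : red w z a 0 -> vge w z pi 1 a.
Proof.
move=> [f [-> fz]].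
have hx : red xi z (intpC f).[xi] 0 by exists f.
have /vge_omega h1 := unramified p_pr pF zP xiP hx.
have h2 := vge_trans (vex_vge vex_p) h1.
have p1 : (1 <= p.-1 * 1)%N.
  by rewrite muln1; case: (p) (prime_gt1 p_pr) => [|[|]].
have h3 := vge_leq red_omega_pi p1 h2.
have -> : (intpC f).[w] = (intpC f).[xi] +
   pi * - \sum_(i < size f) (f`_i)%:~R * xi ^+ i * \sum_(j < i) zeta ^+ j.
  rewrite /intpC !horner_intr mulrN -mulNr opprB mulr_sumr -big_split /=.
  apply: eq_bigr => i _.
  have := subrX1 zeta i; rewrite exprMn => e.
  transitivity ((f`_i)%:~R * xi ^+ i + (f`_i)%:~R * xi ^+ i * (zeta ^+ i - 1)).
    by ring.
  by rewrite e; ring.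
apply: vgeD => //.
exists 1, (- \sum_(i < size f) (f`_i)%:~R * xi ^+ i * \sum_(j < i) zeta ^+ j),
  1, (- \sum_(i < size f) (f`_i)%:~R * z ^+ i * \sum_(j < i) 1 ^+ j).
split; [exact: red1|exact: oner_neq0| |by rewrite mul1r expr1].
apply: redN; apply: red_sum => i _; apply: redM; last first.
  by apply: red_sum => j _; apply: redX red_omega_zeta.
by apply: redM; [exact: red_int|apply: redX; exact: red_omega_xi].
Qed.

End Ramified.

(** * Teichmueller lifts and interpolation *)

Lemma sum_unity_roots (F : finFieldType) (A : nmodType) n (x0 : F) (f : F -> A) :
  n.-primitive_root x0 ->
  \sum_(x | x ^+ n == 1) f x = \sum_(i < n) f (x0 ^+ i).
Proof.
move=> x0P; have n0 := prim_order_gt0 x0P.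
rewrite (reindex_onto (fun i : 'I_n => x0 ^+ i)
  (fun x => odflt (Ordinal n0) [pick i : 'I_n | x0 ^+ i == x])) /=; last first.
  move=> x /eqP /(prim_rootP x0P) [i ei]; case: pickP => [j /eqP //|/(_ i)].
  by rewrite ei eqxx.
apply: eq_bigl => i; rewrite exprAC (prim_expr_order x0P) expr1n eqxx /=.
case: pickP => [j|/(_ i)]; last by rewrite eqxx.
by rewrite (eq_prim_root_expr x0P) !modn_small // => /eqP ij; apply/eqP/val_inj.
Qed.

Lemma sum_prim_root_pow (A : idomainType) n (x0 : A) d :
  n.-primitive_root x0 ->
  \sum_(i < n) (x0 ^+ d) ^+ i = if (n %| d)%N then n%:R else 0.
Proof.
move=> x0P; rewrite (prim_order_dvd x0P); case: eqP => [->|/eqP ne].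
  rewrite (eq_bigr (fun=> 1)) => [|i _]; last by rewrite expr1n.
  by rewrite sumr_const card_ord.
apply/eqP; have := subrX1 (x0 ^+ d) n.
rewrite exprAC (prim_expr_order x0P) expr1n subrr => /esym /eqP.
by rewrite mulf_eq0 subr_eq0 (negPf ne).
Qed.

Section Teichmuller.
Variables (N : nat) (F : finFieldType) (z : F) (xi : algC).
Hypotheses (cardF : #|F| = N.+1).
Hypotheses (zP : N.-primitive_root z) (xiP : N.-primitive_root xi).

Let N_gt0 : (0 < N)%N := prim_order_gt0 zP.

Local Notation T := (tlift N z xi).

Lemma expf_order (x : F) : x != 0 -> x ^+ N = 1.
Proof.
move=> x0; apply: (mulIf x0); rewrite mul1r -exprSr -cardF; exact: expf_card.
Qed.

Lemma expf_order_eq1 (x : F) : (x ^+ N == 1) = (x != 0).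
Proof.
have [->|x0] := eqVneq x 0; last by rewrite expf_order ?eqxx.
by rewrite expr0n (gtn_eqF N_gt0) eq_sym oner_eq0.
Qed.

Lemma expf_prim_root (x : F) : x != 0 -> {i : nat | x = z ^+ i}.
Proof. by move=> /expf_order /(prim_rootP zP) [i ->]; exists (val i). Qed.

Lemma tliftX i : T (z ^+ i) = xi ^+ i.
Proof.
rewrite /tlift; case: pickP => [j|].
  by rewrite (eq_prim_root_expr zP) -(eq_prim_root_expr xiP) => /eqP.
move=> /(_ (Ordinal (ltn_pmod i N_gt0))) /=.
by rewrite (prim_expr_mod zP) eqxx.
Qed.

Lemma z_neq0 : z != 0.
Proof. by rewrite -expf_order_eq1 (prim_expr_order zP). Qed.

Lemma tlift0 : T 0 = 0.
Proof.
rewrite /tlift; case: pickP => [j|//].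
by rewrite expf_eq0 (negPf z_neq0) andbF.
Qed.

Lemma tlift1 : T 1 = 1.
Proof. by rewrite -(expr0 z) tliftX expr0. Qed.

Lemma tliftM x y : T (x * y) = T x * T y.
Proof.
have [->|/expf_prim_root [i ->]] := eqVneq x 0; first by rewrite mul0r tlift0 mul0r.
have [->|/expf_prim_root [j ->]] := eqVneq y 0; first by rewrite mulr0 tlift0 mulr0.
by rewrite -exprD !tliftX exprD.
Qed.

Lemma tlift_exp x n : T (x ^+ n) = T x ^+ n.
Proof. by elim: n => [|n IH]; rewrite ?tlift1 // !exprS tliftM IH. Qed.

Lemma tlift_order x : x != 0 -> T x ^+ N = 1.
Proof. by move=> /expf_order; rewrite -tlift_exp => ->; exact: tlift1. Qed.

Lemma red_tlift x : red xi z (T x) x.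
Proof.
have [->|/expf_prim_root [i ->]] := eqVneq x 0; first by rewrite tlift0; exact: red0.
by rewrite tliftX; apply: redX; exact: red_gen.
Qed.

Lemma sum_neq0 (A : nmodType) (f : F -> A) :
  \sum_(x | x != 0) f x = \sum_(i < N) f (z ^+ i).
Proof. by rewrite -(sum_unity_roots _ zP); apply: eq_bigl => x; rewrite expf_order_eq1. Qed.

Lemma sum_tlift_pow d :
  \sum_(x | x != 0) T x ^+ d = if (N %| d)%N then N%:R else 0.
Proof.
rewrite sum_neq0 -(sum_prim_root_pow _ xiP); apply: eq_bigr => i _.
by rewrite tliftX exprAC.
Qed.

Lemma sum_pow_tlift x : x != 0 ->
  \sum_(i < N) T x ^+ i = if x == 1 then N%:R else 0.
Proof.
move=> /expf_prim_root [i ->].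
by rewrite tliftX (sum_prim_root_pow _ xiP) (prim_order_dvd zP).
Qed.

(* The inverse, up to the factor [N], of the matrix of the [T x ^+ r],
   [x : F], [r <= N]. *)
Definition interp (x : F) (r : nat) : algC :=
  if r == 0%N then N%:R *+ (x == 0)
  else if x == 0 then - (N%:R *+ (r == N)) else T x ^+ (N - r).

Lemma integral_interp x r : integral xi z (interp x r).
Proof.
rewrite /interp; do 2?case: ifP => _.
- exists (N%:R *+ (x == 0)).
  by rewrite -[N%:R *+ _]mulrnA -[X in red _ _ _ X]mulrnA; exact: red_nat.
- exists (- (N%:R *+ (r == N))); apply: redN.
  by rewrite -[N%:R *+ _]mulrnA -[X in red _ _ _ X]mulrnA; exact: red_nat.
by exists (x ^+ (N - r)); apply: redX; exact: red_tlift.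
Qed.

(** For x = 0 only r = 0 and r = N contribute, giving N - N T(y)^N; for x nonzero the sum is
    geometric in T(y/x). *)
Lemma interp_sum_index x y :
  \sum_(r < N.+1) interp x r * T y ^+ r = N%:R *+ (x == y).
Proof.
rewrite big_ord_recl /= expr0 mulr1 /interp /=.
have [->|x0] := eqVneq x 0.
  have To := tlift_order (x := y).
  have := tlift0; case: N N_gt0 To => // M _ To T0; rewrite big_ord_recr /= eqxx mulr1n.
  rewrite big1 ?add0r => [|i _]; last first.
    by rewrite /bump /= add1n eqSS (ltn_eqF (ltn_ord i)) mulr0n oppr0 mul0r.
  have [<-|y0] := eqVneq 0 y; last first.
    by rewrite To 1?eq_sym // mulr1 subrr.
  by rewrite T0 expr0n /= mulr0 addr0.
rewrite mulr0n add0r.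
have [->|y0] := eqVneq y 0.
  rewrite big1 ?(negPf x0) // => i _.
  by rewrite tlift0 exprS mul0r mulr0.
have e (i : 'I_N) : T x ^+ (N - lift ord0 i) * T y ^+ (lift ord0 i) =
    T (y / x) * T (y / x) ^+ i.
  rewrite -exprS -[RHS]mul1r -(tlift_order x0) /= /bump /= add1n.
  have -> : T x ^+ N = T x ^+ (N - i.+1) * T x ^+ i.+1 by rewrite -exprD subnK.
  rewrite -mulrA -exprMn -tliftM.
  by rewrite mulrC [x * _]mulrC divfK // mulrC.
rewrite (eq_bigr _ (fun i _ => e i)) -mulr_sumr.
rewrite sum_pow_tlift ?mulf_neq0 ?invr_eq0 //.
rewrite -(inj_eq (mulIf x0)) divfK // mul1r [y == x]eq_sym.
by case: eqP => [<-|_]; rewrite ?mulr0 // divff // tlift1 mul1r.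
Qed.

(** Orthogonality over the nonzero x sees exponents only modulo N; the term x = 0, with T(0)^0 = 1,
    separates 0 from N. *)
Lemma interp_sum_point r s : (r <= N)%N -> (s <= N)%N ->
  \sum_x interp x r * T x ^+ s = N%:R *+ (r == s).
Proof.
move=> rN sN; rewrite (bigD1 0) //= tlift0 /interp eqxx.
case: eqVneq => [->|r0].
  rewrite big1 ?addr0 => [|x /negPf ->]; last by rewrite mulr0n mul0r.
  by rewrite expr0n mulr1n mulr_natr [s == _]eq_sym.
rewrite (eq_bigr (fun x => T x ^+ (N - r + s))) => [|x /negPf ->]; last first.
  by rewrite exprD.
rewrite sum_tlift_pow expr0n.
have [->|rN'] := eqVneq r N.
  rewrite subnn add0n mulr1n; have [->|s0] := eqVneq s 0%N.
    by rewrite dvdn0 mulr1 addNr (gtn_eqF N_gt0).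
  rewrite mulr0 add0r; have [<-|ns] := eqVneq N s; first by rewrite dvdnn.
  case: ifP => // /dvdn_leq; rewrite lt0n s0 => /(_ isT).
  by rewrite leqNgt ltn_neqAle eq_sym ns sN.
rewrite mulr0n oppr0 mul0r add0r.
have -> : (N %| N - r + s)%N = (r == s).
  apply/idP/eqP => [|<-]; last by rewrite subnK.
  move=> /dvdnP [c ec]; case: c ec => [|[|c]]; [lia|lia|].
  by rewrite !mulSn => ?; have := leq_pmulr c N_gt0; lia.
by case: eqP.
Qed.

Section Expansion.
Variable f : F -> algC.

Definition tcoef (r : nat) : algC := \sum_x interp x r * f x.

Lemma tcoef_expand y : N%:R * f y = \sum_(r < N.+1) tcoef r * T y ^+ r.
Proof.
under eq_bigr do rewrite mulr_suml.
rewrite exchange_big /= (bigD1 y) //=.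
under eq_bigr do rewrite mulrAC.
rewrite -mulr_suml interp_sum_index eqxx mulr1n.
rewrite big1 ?addr0 // => x xy.
under eq_bigr do rewrite mulrAC.
by rewrite -mulr_suml interp_sum_index (negPf xy) mulr0n mul0r.
Qed.

End Expansion.

(* Injectivity of the evaluation of reduced polynomials in [k] variables at
   Teichmueller points, made explicit. *)
Lemma interp_multi k (a : {ffun 'I_k -> 'I_N.+1} -> algC) (r : {ffun 'I_k -> 'I_N.+1}) :
  \sum_(u : {ffun 'I_k -> F}) (\prod_i interp (u i) (r i)) *
     (\sum_s a s * \prod_i T (u i) ^+ (s i)) = N%:R ^+ k * a r.
Proof.
under eq_bigr do rewrite mulr_sumr.
rewrite exchange_big /=.
have e s : \sum_(u : {ffun 'I_k -> F}) \prod_i interp (u i) (r i) *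
     (a s * \prod_i T (u i) ^+ (s i)) = a s * \prod_i (N%:R *+ (r i == s i)).
  transitivity (a s * \prod_(i < k) \sum_x interp x (r i) * T x ^+ (s i)).
    rewrite bigA_distr_bigA mulr_sumr; apply: eq_bigr => u _.
    by rewrite big_split /= mulrCA.
  congr (_ * _); apply: eq_bigr => i _; rewrite interp_sum_point //; first by rewrite -ltnS.
  by rewrite -ltnS.
rewrite (eq_bigr _ (fun s _ => e s)) (bigD1 r) //= [X in _ + X]big1 ?addr0.
  under eq_bigr do rewrite eqxx mulr1n.
  by rewrite prodr_const card_ord mulrC.
move=> s sr.
have [i ri] : exists i, r i != s i.
  apply/existsP; move: sr; apply: contraNT => /existsPn h.
  by apply/eqP/ffunP => i; move: (h i); rewrite negbK => /eqP.
by rewrite (bigD1 i) //= (negPf ri) mulr0n mul0r mulr0.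
Qed.

End Teichmuller.

(** * Traces and additive characters *)

Section Trace.
Variables (p : nat) (F : finFieldType).
Hypotheses (p_pr : prime p) (pF : p \in [pchar F]).

Lemma expDp n (x y : F) : (x + y) ^+ (p ^ n) = x ^+ (p ^ n) + y ^+ (p ^ n).
Proof.
apply: exprDn_pchar; apply/pnatP => [|r r_pr]; first by rewrite expn_gt0 prime_gt0.
rewrite (Euclid_dvdX _ _ r_pr) => /andP [+ _].
by rewrite dvdn_prime2 // => /eqP ->.
Qed.

Lemma exp_sum_p n I (s : seq I) (P : pred I) (f : I -> F) :
  (\sum_(i <- s | P i) f i) ^+ (p ^ n) = \sum_(i <- s | P i) f i ^+ (p ^ n).
Proof.
apply: (big_morph (fun x => x ^+ (p ^ n))) => [x y|]; first exact: expDp.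
by rewrite expr0n expn_eq0 (gtn_eqF (prime_gt0 p_pr)).
Qed.

Lemma traceD a m (x y : F) :
  trace (p ^ a) m (x + y) = trace (p ^ a) m x + trace (p ^ a) m y.
Proof.
by rewrite /trace -big_split; apply: eq_bigr => i _; rewrite -expnM expDp.
Qed.

Lemma trace1D m (x y : F) : trace p m (x + y) = trace p m x + trace p m y.
Proof. by rewrite -[p]expn1; exact: traceD. Qed.

Lemma trace_tower a m (x : F) : trace p (a * m) x = trace p a (trace (p ^ a) m x).
Proof.
elim: m => [|m IH].
  rewrite muln0 /trace !big_ord0 big1 // => i _.
  by rewrite expr0n expn_eq0 (gtn_eqF (prime_gt0 p_pr)).
have -> : trace (p ^ a) m.+1 x = trace (p ^ a) m x + x ^+ ((p ^ a) ^ m).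
  by rewrite /trace big_ord_recr.
rewrite trace1D -IH mulnS addnC.
rewrite /trace big_split_ord /=; congr (_ + _); apply: eq_bigr => i _ /=.
by rewrite -exprM -expnM -expnD.
Qed.

Lemma exp_fix_iter q (b : F) i : b ^+ q = b -> b ^+ (q ^ i) = b.
Proof. by move=> e; elim: i => [|i IH]; rewrite ?expr1 // expnS exprM e. Qed.

Lemma traceZ q m (b x : F) : b ^+ q = b -> trace q m (b * x) = b * trace q m x.
Proof.
move=> e; rewrite /trace mulr_sumr; apply: eq_bigr => i _.
by rewrite exprMn (exp_fix_iter _ e).
Qed.

Lemma trace_fix a m (x : F) : x ^+ ((p ^ a) ^ m) = x ->
  (trace (p ^ a) m x) ^+ (p ^ a) = trace (p ^ a) m x.
Proof.
move=> e; rewrite /trace exp_sum_p.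
case: m e => [|m] e; first by rewrite !big_ord0.
rewrite big_ord_recr big_ord_recl /= addrC -exprM -expnSr e expr1.
by congr (_ + _); apply: eq_bigr => i _; rewrite -exprM -expnSr.
Qed.

(** X^p - X splits over ['F_p] into the factors X - c, so its roots in F are images of integers. *)
Lemma prime_field_nat (y : F) : y ^+ p = y -> exists k : 'I_p, k%:R == y.
Proof.
move=> yp; have [iota _] := prime_field_embedding pF.
have p1 := prime_gt1 p_pr.
have : root ('X^p - 'X) y by rewrite /root !hornerE yp subrr.
have -> : 'X^p - 'X = map_poly iota ('X^p - 'X).
  by rewrite rmorphB /= map_polyXn map_polyX.
rewrite -[in X in 'X^X](card_Fp p_pr) finField_genPoly rmorph_prod /=.
rewrite /root horner_prod prodf_seq_eq0 => /hasP [c _ /=].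
rewrite rmorphB /= map_polyX map_polyC /= !hornerE subr_eq0 => /eqP ->.
have cp : ((c : nat) < p)%N by have := ltn_ord c; rewrite [X in (_ < X)%N]Fp_cast.
by exists (Ordinal cp); rewrite /= -[in X in _ == X](natr_Zp c) rmorph_nat.
Qed.

(** The trace is a polynomial of degree at most p^(a-1), nonzero because X has coefficient 1, so it
    cannot vanish on a larger set. *)
Lemma trace_nontrivial a (A : {pred F}) : (0 < a)%N -> (p ^ a.-1 < #|A|)%N ->
  exists2 b, b \in A & trace p a b != 0.
Proof.
move=> a0 cA; apply/exists_inP; apply: contraTT cA => /exists_inPn h; rewrite -leqNgt.
pose P : {poly F} := \sum_(i < a) 'X^(p ^ i).
have sP : (size P <= (p ^ a.-1).+1)%N.
  apply: (leq_trans (size_sum _ _ _)); apply/bigmax_leqP => i _.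
  rewrite size_polyXn ltnS leq_exp2l ?prime_gt1 //.
  by have := ltn_ord i; lia.
have P0 : P != 0.
  apply/negP => /eqP /(congr1 (fun q : {poly F} => q`_1)).
  rewrite /P coef0 coef_sum.
  clear h P sP; case: a a0 => // a _; rewrite big_ord_recl big1 => [|i _].
    by rewrite expn0 coefXn addr0 => /eqP; rewrite oner_eq0.
  rewrite coefXn /= /bump /= add1n expnS.
  by case: eqP => // e; move: (prime_gt1 p_pr); have := expn_gt0 p i; nia.
have := max_poly_roots P0 (rs := enum A); rewrite -cardE => H.
rewrite -ltnS; apply: leq_trans sP; apply: H; last exact: enum_uniq.
apply/allP => x; rewrite mem_enum => /h; rewrite negbK => /eqP e.
rewrite /root /P horner_sum -[X in _ == X]e; apply/eqP; apply: eq_bigr => i _.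
by rewrite hornerXn.
Qed.

End Trace.

Lemma dvdn_pred_predX q m : (q.-1 %| (q ^ m).-1)%N.
Proof. by rewrite predn_exp dvdn_mulr. Qed.

Section Character.
Variables (p h : nat) (F : finFieldType) (z : F) (zeta : algC).
Hypotheses (p_pr : prime p) (h_gt0 : (0 < h)%N) (cardF : #|F| = (p ^ h)%N).
Hypotheses (zP : ((p ^ h).-1).-primitive_root z) (zetaP : p.-primitive_root zeta).

Let pF : p \in [pchar F] := card_finPcharP cardF p_pr.

(** The trace lies in the prime field and needs a representative to serve as an exponent of zeta;
    the default 0 is never taken, by [prime_field_nat]. *)
Definition trexp (x : F) : nat :=
  if [pick k : 'I_p | k%:R == trace p h x] is Some k then k : nat else 0%N.

Lemma expf_cardp (x : F) : x ^+ (p ^ h) = x.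
Proof. by rewrite -cardF expf_card. Qed.

Lemma trexpE (x : F) : (trexp x)%:R = trace p h x.
Proof.
rewrite /trexp; case: pickP => [k /eqP //|no].
have e : trace p h x ^+ p = trace p h x.
  by have := @trace_fix p F p_pr pF 1 h x; rewrite expn1; apply; exact: expf_cardp.
by have [k] := prime_field_nat p_pr pF e; rewrite no.
Qed.

Definition achar (x : F) : algC := zeta ^+ trexp x.

Lemma eq_expr_zeta a b : a%:R = b%:R :> F -> zeta ^+ a = zeta ^+ b.
Proof.
wlog ab : a b / (a <= b)%N.
  by move=> H e; case: (leqP a b) => [/H|/ltnW /H H']; [exact|rewrite H'].
move=> e; rewrite -(subnK ab) exprD.
have /dvdnP [c ->] : (p %| b - a)%N by rewrite (dvdn_pcharf pF) natrB // e subrr.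
by rewrite mulnC exprM (prim_expr_order zetaP) expr1n mul1r.
Qed.

Lemma acharD x y : achar (x + y) = achar x * achar y.
Proof.
rewrite /achar -exprD; apply: eq_expr_zeta.
by rewrite natrD !trexpE (trace1D p_pr pF).
Qed.

Lemma achar_eq1 x : (achar x == 1) = (trace p h x == 0).
Proof. by rewrite /achar -(prim_order_dvd zetaP) (dvdn_pcharf pF) trexpE. Qed.

Lemma achar0 : achar 0 = 1.
Proof.
apply/eqP; rewrite achar_eq1 /trace big1 // => i _.
by rewrite expr0n expn_eq0 (gtn_eqF (prime_gt0 p_pr)).
Qed.

Lemma achar_sum I (s : seq I) (f : I -> F) :
  achar (\sum_(i <- s) f i) = \prod_(i <- s) achar (f i).
Proof. exact: (big_morph achar acharD achar0). Qed.

Lemma achar_frob x : achar (x ^+ p) = achar x.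
Proof.
rewrite /achar; apply: eq_expr_zeta; rewrite !trexpE /trace.
have := expf_cardp x; case: h => [|j] e; first by rewrite !big_ord0.
rewrite big_ord_recr big_ord_recl /= addrC -exprM -expnS e expr1.
by congr (_ + _); apply: eq_bigr => i _; rewrite -exprM -expnS.
Qed.

Lemma card_fix a m : (0 < a)%N -> h = (a * m)%N ->
  #|[pred b : F | b ^+ (p ^ a) == b]| = (p ^ a)%N.
Proof.
move=> a0 hm; set q := (p ^ a)%N.
have q1 : (1 < q)%N by rewrite -(exp1n a) ltn_exp2r // prime_gt1.
have x0P : (q.-1).-primitive_root (z ^+ ((p ^ h).-1 %/ q.-1)).
  by apply: (dvdn_prim_root zP); rewrite hm expnM dvdn_pred_predX.
rewrite -sum1_card (bigD1 0) /=; last by rewrite inE expr0n (gtn_eqF (ltnW q1)).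
rewrite (eq_bigl (fun x : F => x ^+ q.-1 == 1)) => [|x].
  rewrite (sum_unity_roots (fun=> 1%N) x0P) sum_nat_const card_ord muln1; lia.
rewrite inE; have [->|x0] := eqVneq x 0.
  have q0 : (q.-1 == 0)%N = false by apply/eqP; lia.
  by rewrite andbF expr0n q0 eq_sym oner_eq0.
rewrite andbT -{1}(prednK (ltnW q1)) exprS -[X in (_ == X) = _]mulr1.
exact: (inj_eq (mulfI x0)).
Qed.

(** By transitivity of the trace, psi(b y) depends only on b Tr(y) for b in the subfield. If Tr(y)
    is nonzero, some translation of the subfield multiplies the sum by a number other than 1. *)
Lemma achar_sum_subfield a m y : (0 < a)%N -> h = (a * m)%N ->
  \sum_(b : F | b ^+ (p ^ a) == b) achar (b * y) =
  if trace (p ^ a) m y == 0 then (p ^ a)%:R else 0.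
Proof.
move=> a0 hm.
have tr b : b ^+ (p ^ a) == b ->
    trace p h (b * y) = trace p a (b * trace (p ^ a) m y).
  by move=> /eqP e; rewrite hm trace_tower // traceZ.
case: eqP => [t0|/eqP t0].
  rewrite (eq_bigr (fun=> 1)) => [|b fb].
    by rewrite sumr_const (card_fix a0 hm).
  apply/eqP; rewrite achar_eq1 tr // t0 mulr0 /trace big1 // => i _.
  by rewrite expr0n expn_eq0 (gtn_eqF (prime_gt0 p_pr)).
have [|b1 fb1 tb1] := trace_nontrivial p_pr pF (A := [pred b : F | b ^+ (p ^ a) == b]) a0.
  by rewrite (card_fix a0 hm) ltn_exp2l ?prime_gt1 //; lia.
set t := trace _ m y in t0 tr *.
have ft : t ^+ (p ^ a) = t.
  by apply: trace_fix => //; rewrite -expnM -hm expf_cardp.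
(* Chosen so that b0 t = b1, which has nonzero trace; t lies in the subfield, hence so does b0. *)
pose b0 := b1 / t.
have fb0 : b0 ^+ (p ^ a) == b0 by rewrite exprMn exprVn ft (eqP fb1).
set S := \sum_(b | _) _.
have e : S = achar (b0 * y) * S.
  rewrite {1}/S (reindex_inj (addIr b0)) mulr_sumr /=.
  apply: eq_big => [b|b _]; last by rewrite mulrDl acharD mulrC.
  by rewrite (expDp p_pr pF) (eqP fb0) (inj_eq (addIr b0)).
apply/eqP; have : (achar (b0 * y) - 1) * S == 0 by rewrite mulrBl mul1r -e subrr.
rewrite mulf_eq0 subr_eq0 achar_eq1 tr // divfK //.
by rewrite (negPf tb1).
Qed.

Lemma achar_sum_full y : \sum_(x : F) achar (x * y) = if y == 0 then (p ^ h)%:R else 0.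
Proof.
have := @achar_sum_subfield h 1 y h_gt0 (esym (muln1 h)).
rewrite /trace big_ord1 expn0 expr1 => <-.
by apply: eq_bigl => x; rewrite expf_cardp eqxx.
Qed.

End Character.

(** * Stickelberger's theorem *)

Section Digits.
Variable p : nat.
Hypothesis p_gt1 : (1 < p)%N.

Lemma digsum_fuel_eq f f' a : (a < f)%N -> (a < f')%N ->
  digsum_fuel f p a = digsum_fuel f' p a.
Proof.
elim: f f' a => // f IH [|f'] a //= af af'; case: eqP => // /eqP a0.
have lt : (a %/ p < a)%N by rewrite ltn_Pdiv // lt0n.
by congr (_ + _)%N; apply: IH; lia.
Qed.

Lemma digsum0 : digsum p 0 = 0%N. Proof. by []. Qed.

Lemma digsum_rec a : digsum p a = (a %% p + digsum p (a %/ p))%N.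
Proof.
have [->|a0] := eqVneq a 0%N; first by rewrite mod0n div0n.
have lt : (a %/ p < a)%N by rewrite ltn_Pdiv // lt0n.
by rewrite {1}/digsum /= (negPf a0) (@digsum_fuel_eq a (a %/ p).+1).
Qed.

Lemma digsumMD a d : (d < p)%N -> digsum p (a * p + d) = (d + digsum p a)%N.
Proof.
move=> dp; have p0 := ltnW p_gt1.
by rewrite digsum_rec modnMDl modn_small // divnMDl // divn_small // addn0.
Qed.

(** All digits of p^j - 1 equal p - 1, so the subtraction needs no borrow. *)
Lemma digsum_compl j a : (a < p ^ j)%N ->
  (digsum p a + digsum p ((p ^ j).-1 - a) = j * p.-1)%N.
Proof.
have p0 := ltnW p_gt1.
elim: j a => [|j IH] a; first by rewrite expn0 ltnS leqn0 => /eqP ->.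
rewrite (divn_eq a p); set b := (a %/ p)%N; set d := (a %% p)%N.
have dp : (d < p)%N by rewrite ltn_mod.
rewrite expnSr => ab.
have bj : (b < p ^ j)%N by rewrite -(ltn_pmul2r p0); lia.
have -> : ((p ^ j * p).-1 - (b * p + d) = ((p ^ j).-1 - b) * p + (p.-1 - d))%N by nia.
rewrite !digsumMD //; last lia.
have := IH b bj; lia.
Qed.

Lemma digsum_mod a : exists c, a = (digsum p a + c * p.-1)%N.
Proof.
have p0 := ltnW p_gt1.
elim/ltn_ind: a => a IH; have [->|a0] := eqVneq a 0%N; first by exists 0%N.
have lt : (a %/ p < a)%N by rewrite ltn_Pdiv // lt0n.
have [c ec] := IH _ lt; rewrite digsum_rec.
exists (c + a %/ p)%N; have := divn_eq a p; nia.
Qed.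

End Digits.

(** * Gauss and Jacobi sums and their valuations *)

Section Stickelberger.
Variables (p h N : nat) (F : finFieldType) (z : F) (xi zeta : algC).
Hypotheses (p_pr : prime p) (h_gt0 : (0 < h)%N) (cardF : #|F| = (p ^ h)%N).
Hypotheses (cardN : (p ^ h)%N = N.+1).
Hypotheses (zP : N.-primitive_root z) (xiP : N.-primitive_root xi).
Hypotheses (zetaP : p.-primitive_root zeta).

Let pF : p \in [pchar F] := card_finPcharP cardF p_pr.
Let cardFN : #|F| = N.+1. Proof. by rewrite cardF. Qed.
Let zP' : ((p ^ h).-1).-primitive_root z. Proof. by rewrite cardN. Qed.
Let p_gt1 : (1 < p)%N := prime_gt1 p_pr.
Let N_gt0 : (0 < N)%N := prim_order_gt0 zP.

Local Notation T := (tlift N z xi).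
Local Notation psi := (achar p h zeta).
Let w := zeta * xi.
Let pi := 1 - zeta.
Local Notation c := (tcoef N z xi (achar p h zeta)).

Let T0 : T 0 = 0 := tlift0 xi cardFN zP.
Let TM x y : T (x * y) = T x * T y := tliftM cardFN zP xiP x y.

Definition gsum (s : nat) : algC := \sum_x T x ^+ s * psi x.

Lemma gsum_neq0 s : (0 < s)%N -> gsum s = \sum_(x | x != 0) T x ^+ s * psi x.
Proof.
move=> s0; rewrite /gsum (bigD1 0) //= T0 expr0n (gtn_eqF s0) mul0r add0r.
by [].
Qed.

Lemma tcoef_gsum r : (0 < r < N)%N -> c r = gsum (N - r).
Proof.
move=> /andP [r0 rN]; rewrite /tcoef gsum_neq0 ?subn_gt0 //.
rewrite (bigD1 0) //= /interp eqxx (gtn_eqF r0) (ltn_eqF rN) mulr0n oppr0 mul0r add0r.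
by apply: eq_bigr => x /negPf ->.
Qed.

Lemma tcoef0 : c 0 = N%:R.
Proof.
rewrite /tcoef (bigD1 0) //= /interp !eqxx mulr1n (achar0 p_pr cardF zetaP) mulr1.
by rewrite big1 ?addr0 // => x /negPf ->; rewrite mulr0n mul0r.
Qed.

Lemma achar_sum_neq0 (y : F) :
  \sum_(x | x != 0) psi (x * y) = (if y == 0 then (p ^ h)%:R else 0) - 1.
Proof.
rewrite -(achar_sum_full p_pr h_gt0 cardF zP' zetaP y) [in RHS](bigD1 0) //=.
by rewrite mul0r (achar0 p_pr cardF zetaP) addrC addrK.
Qed.

Lemma tcoef_last : c N = - (p ^ h)%:R.
Proof.
rewrite /tcoef (bigD1 0) //= /interp !eqxx (gtn_eqF N_gt0) mulr1n.
rewrite (achar0 p_pr cardF zetaP) mulr1.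
rewrite (eq_bigr (fun x => psi (x * 1))) => [|x /negPf ->]; last first.
  by rewrite subnn expr0 mul1r mulr1.
rewrite achar_sum_neq0 oner_eq0 cardN -addn1 natrD; ring.
Qed.

Lemma tlift_expDN (x : F) e : (0 < e)%N -> T x ^+ (N + e) = T x ^+ e.
Proof.
move=> e0; have [->|x0] := eqVneq x 0.
  by rewrite T0 !expr0n (gtn_eqF e0) gtn_eqF // addn_gt0 e0 orbT.
by rewrite exprD (tlift_order cardFN zP xiP x0) mul1r.
Qed.

Lemma gsumDN e : (0 < e)%N -> gsum (N + e) = gsum e.
Proof. by move=> e0; apply: eq_bigr => x _; rewrite tlift_expDN. Qed.

Lemma gsum_frob e : gsum (p * e) = gsum e.
Proof.
rewrite /gsum [RHS](reindex_inj (fmorph_inj (pFrobenius_aut pF))) /=.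
apply: eq_bigr => x _; rewrite pFrobenius_autE (achar_frob p_pr cardF zetaP).
by rewrite (tlift_exp cardFN zP xiP) -exprM.
Qed.

Definition jacobi a b : algC := \sum_x T x ^+ a * T (1 - x) ^+ b.

(** Group the pairs by the sum s of their arguments. A nonzero s scales out as T(s)^(a+b); the slice
    s = 0 is a multiple of the sum of T^(a+b), which vanishes since N does not divide a + b. *)
Lemma gsum_jacobi a b : ~~ (N %| a + b)%N -> (0 < a + b)%N ->
  gsum a * gsum b = jacobi a b * gsum (a + b).
Proof.
move=> nab ab0; rewrite /gsum mulr_suml.
transitivity (\sum_x \sum_s T x ^+ a * T (s - x) ^+ b * psi s).
  apply: eq_bigr => x _; rewrite mulr_sumr (reindex_inj (addIr (- x))) /=.
  apply: eq_bigr => s _.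
  have -> : psi s = psi x * psi (s - x).
    by rewrite -(acharD p_pr cardF zetaP) addrC subrK.
  ring.
rewrite exchange_big mulr_sumr; apply: eq_bigr => s _ /=.
rewrite -mulr_suml mulrA; congr (_ * _).
have [->|s0] := eqVneq s 0.
  rewrite T0 expr0n (gtn_eqF ab0) mulr0.
  under eq_bigr do rewrite sub0r -mulN1r TM exprMn mulrCA -exprD.
  rewrite -mulr_sumr (bigD1 0) //= T0 expr0n (gtn_eqF ab0) add0r.
  by rewrite (sum_tlift_pow cardFN zP xiP) (negPf nab) mulr0.
rewrite (reindex_inj (mulfI s0)) /= /jacobi mulr_suml.
apply: eq_bigr => x _; rewrite -{2}[s]mulr1 -mulrBr !TM !exprMn exprD; ring.
Qed.

(** After the substitution x = y t the sum over y isolates t = -1, and the remaining -1 is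
    multiplied by the vanishing sum of T^a. *)
Lemma gsum_compl a b : (0 < a)%N -> (0 < b)%N -> (a + b = N)%N ->
  gsum a * gsum b = (p ^ h)%:R * T (-1) ^+ a.
Proof.
move=> a0 b0 ab.
rewrite (gsum_neq0 b0) mulrC mulr_suml.
transitivity (\sum_(y | y != 0) \sum_(t | t != 0) T t ^+ a * psi (y * (t + 1))).
  apply: eq_bigr => y y0; rewrite /gsum (reindex_inj (mulfI y0)) /= mulr_sumr.
  rewrite (bigD1 0) //= mulr0 T0 expr0n (gtn_eqF a0) mul0r mulr0 add0r.
  apply: eq_bigr => t _; rewrite mulrDr mulr1 (acharD p_pr cardF zetaP) TM exprMn.
  have e : T y ^+ a * T y ^+ b = 1.
    by rewrite -exprD ab; exact: (tlift_order cardFN zP xiP y0).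
  transitivity ((T y ^+ a * T y ^+ b) * (T t ^+ a * psi (y * t) * psi y)); first by ring.
  by rewrite e mul1r mulrA.
rewrite exchange_big /=.
under eq_bigr do rewrite -mulr_sumr achar_sum_neq0 mulrBr mulr1.
rewrite sumrB (sum_tlift_pow cardFN zP xiP).
have -> : (N %| a)%N = false by apply/negP => /(dvdn_leq a0); lia.
rewrite subr0 (bigD1 (-1)) ?oppr_eq0 ?oner_eq0 //= addNr eqxx.
rewrite [X in _ + X]big1 => [|t /andP [_ t1]]; first by rewrite addr0 mulrC.
by rewrite addr_eq0 (negPf t1) mulr0.
Qed.

Lemma red_achar (x : F) : red w z (psi x) 1.
Proof.
rewrite /achar -(expr1n F (trexp p h x)); apply: redX.
exact: (red_omega_zeta p_pr pF zP xiP zetaP).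
Qed.

Lemma red_omega_tlift (x : F) : red w z (T x) x.
Proof.
apply: (red_omega p_pr pF zP xiP zetaP); exact: (red_tlift cardFN zP xiP).
Qed.

Lemma integral_gsum s : integral w z (gsum s).
Proof.
apply: integral_sum => x _; apply: integralM; last by exists 1; exact: red_achar.
by exists (x ^+ s); apply: redX; exact: red_omega_tlift.
Qed.

Lemma integral_jacobi a b : integral w z (jacobi a b).
Proof.
apply: integral_sum => x _; exists (x ^+ a * (1 - x) ^+ b).
by apply: redM; apply: redX; exact: red_omega_tlift.
Qed.

Lemma sum_pow_neq0 d : \sum_(x : F | x != 0) x ^+ d = if (N %| d)%N then N%:R else 0.
Proof.
rewrite (sum_neq0 cardFN zP) -(sum_prim_root_pow d zP); apply: eq_bigr => i _.
by rewrite exprAC.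
Qed.

(** As T^(N-1) sums to 0, psi may be replaced by psi - 1, which is divisible by pi. The cofactor
    reduces to minus the sum of Tr(x)/x; only the conjugate x itself survives there, and the result
    is -N = 1 in F. *)
Lemma vex_gsum1 : (1 < N)%N -> vex w z pi 1 (gsum N.-1).
Proof.
move=> N1.
have e : gsum N.-1 =
    pi * - \sum_(x | x != 0) T x ^+ N.-1 * \sum_(i < trexp p h x) zeta ^+ i.
  rewrite gsum_neq0; last lia.
  transitivity (\sum_(x | x != 0) T x ^+ N.-1 +
     \sum_(x | x != 0) T x ^+ N.-1 * (psi x - 1)).
    by rewrite -big_split; apply: eq_bigr => x _ /=; ring.
  rewrite (sum_tlift_pow cardFN zP xiP).
  have -> : (N %| N.-1)%N = false by apply/negP => /dvdn_leq; lia.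
  rewrite add0r mulrN -mulNr opprB mulr_sumr; apply: eq_bigr => x _.
  by rewrite /achar subrX1 mulrCA.
rewrite e; set S := - _.
have hS : red w z S 1.
  have -> : 1 = - \sum_(x | x != 0) x ^+ N.-1 * \sum_(i < trexp p h x) 1 ^+ i :> F.
    apply/eqP; rewrite -eqr_oppLR; apply/eqP/esym.
    transitivity (\sum_(x : F | x != 0) x ^+ N.-1 * trace p h x).
      apply: eq_bigr => x _; rewrite -(trexpE p_pr cardF); congr (_ * _).
      rewrite (eq_bigr (fun=> 1)) => [|i _]; last by rewrite expr1n.
      by rewrite sumr_const card_ord.
    under eq_bigr do rewrite mulr_sumr.
    rewrite exchange_big /=.
    case: h h_gt0 cardN => // j _ cN; rewrite big_ord_recl [X in _ + X]big1 => [|i _].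
      rewrite addr0 expn0 (eq_bigr (fun=> 1)) => [|x x0]; last first.
        by rewrite -exprD addn1 prednK // (expf_order cardFN).
      rewrite sumr_const.
      have -> : #|[pred x : F | x != 0]| = N.
        have := cardC1 (0 : F); rewrite cardFN /= => <-; apply: eq_card => x.
        by rewrite !inE.
      apply/eqP; rewrite -addr_eq0 -(natrD _ N 1) addn1 -cN expnS natrM.
      by rewrite (pcharf0 pF) mul0r.
    rewrite (eq_bigr (fun x => x ^+ (N.-1 + p ^ lift ord0 i))) => [|x _]; last first.
      by rewrite exprD.
    rewrite sum_pow_neq0.
    have -> : (N %| N.-1 + p ^ lift ord0 i)%N = false; last by [].
    (* The exponent lies strictly between N and 2N, so its power sum vanishes. *)
    have e1 : (p <= p ^ lift ord0 i)%N by rewrite -{1}(expn1 p) leq_exp2l.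
    have e2 : (p ^ lift ord0 i < p ^ j.+1)%N by rewrite ltn_exp2l.
    have e3 : (p ^ lift ord0 i * 2 <= p ^ j.+1)%N.
      have -> : (p ^ j.+1 = p ^ lift ord0 i * p ^ (j.+1 - lift ord0 i))%N.
        by rewrite -expnD subnKC // ltnW // ltn_ord.
      rewrite leq_mul2l; apply/orP; right; apply: (leq_trans p_gt1).
      rewrite -{1}(expn1 p) leq_exp2l // subn_gt0; exact: ltn_ord.
    apply/negP => /dvdnP [[|[|d]] ed]; [lia|lia|].
    by move: ed; rewrite !mulSn; lia.
  apply: redN; apply: red_sum => x _; apply: redM.
    by apply: redX; exact: red_omega_tlift.
  apply: red_sum => i _; apply: redX.
  exact: (red_omega_zeta p_pr pF zP xiP zetaP).
exists 1, S, 1, 1; split; [exact: red1|exact: oner_neq0|exact: hS|].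
by split; rewrite ?oner_neq0 // mul1r expr1.
Qed.

Let wd := @omega_wd p N F z xi zeta p_pr pF zP xiP zetaP.
Let pi0 : pi != 0 := pi_neq0 p_pr zetaP.
Let hpi : red w z pi 0 := red_omega_pi p_pr pF zP xiP zetaP.

Lemma vex_card : vex w z pi (h * p.-1) (p ^ h)%:R.
Proof.
rewrite natrX mulnC; apply: vexX; exact: (vex_p p_pr pF zP xiP zetaP).
Qed.

(** The product of the two sums is p^h times a unit, so [vex_split] applies. *)
Lemma vex_gsum_compl a b : (0 < a)%N -> (0 < b)%N -> (a + b = N)%N ->
  exists t t', [/\ vex w z pi t (gsum a), vex w z pi t' (gsum b) & (t + t' = h * p.-1)%N].
Proof.
move=> a0 b0 ab; apply: (vex_split wd pi0 hpi); try exact: integral_gsum.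
  exact: (omega_loc p_pr pF zP xiP zetaP).
rewrite gsum_compl // -[(h * _)%N]addn0; apply: vexM; first exact: vex_card.
apply: vex0; first by apply: redX; exact: red_omega_tlift.
by rewrite expf_neq0 // oppr_eq0 oner_neq0.
Qed.

(** Induction on r through its last digit. If it is 0, Frobenius replaces r by r/p. Otherwise the
    product of the Gauss sums of exponents N - 1 and N - (r - 1) is an integral Jacobi sum times
    that of N - r, so the valuation grows by at most 1 from r - 1 to r, while S_p grows by exactly
    1. *)
Lemma gsum_val_le r : (0 < r < N)%N ->
  exists2 t, vex w z pi t (gsum (N - r)) & (t <= digsum p r)%N.
Proof.
elim/ltn_ind: r => r IH /andP [r0 rN].
have p0 := prime_gt0 p_pr.
have := divn_eq r p; set r' := (r %/ p)%N; set d := (r %% p)%N => er.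
have dp : (d < p)%N by rewrite ltn_mod.
have [d0|d0] := eqVneq d 0%N.
  rewrite d0 addn0 in er.
  have r'0 : (0 < r')%N by lia.
  have r'r : (r' < r)%N by nia.
  have [|t ht le] := IH r' r'r; first lia.
  exists t; last by rewrite er -[(r' * p)%N]addn0 digsumMD // add0n.
  rewrite -gsum_frob in ht.
  suff -> : gsum (N - r) = gsum (p * (N - r')) by [].
  have -> : (p * (N - r') = p.-1 * N + (N - r))%N by nia.
  elim: (p.-1) => [|m IHm]; first by rewrite mul0n add0n.
  by rewrite mulSn -addnA gsumDN //; lia.
have [r1|r1] := eqVneq r 1%N.
  exists 1%N; first by rewrite r1 subn1; apply: vex_gsum1; lia.
  by rewrite r1 -[1%N]/(0 * p + 1)%N digsumMD.
have [||t ht le] := IH r.-1; [lia|lia|].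
have h1 : vex w z pi 1 (gsum N.-1) by apply: vex_gsum1; lia.
(* The exact valuation must be known to exist before it can be bounded. *)
have [t1 [t2 [ht1 _ _]]] : exists t t', [/\ vex w z pi t (gsum (N - r)),
   vex w z pi t' (gsum r) & (t + t' = h * p.-1)%N].
  by apply: vex_gsum_compl; lia.
exists t1 => //.
have -> : digsum p r = (1 + digsum p r.-1)%N.
  have -> : r.-1 = (r' * p + d.-1)%N by lia.
  rewrite {1}er !digsumMD //; lia.
suff : (t1 <= 1 + t)%N by lia.
apply: (vex_max wd pi0 hpi (vexM h1 ht)).
rewrite gsum_jacobi; [|apply/negP => /dvdnP [[|[|m]]]; nia|lia].
have -> : (N.-1 + (N - r.-1) = N + (N - r))%N by lia.
rewrite gsumDN; last lia.
rewrite -[t1]add0n; apply: vgeM (vex_vge ht1).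
exact: (vge_integral pi (integral_jacobi _ _)).
Qed.

(** For 0 < r < N the bounds S_p(r) and S_p(N - r) add up to h(p - 1), the exact valuation of the
    product of the two Gauss sums, so neither is strict. At the ends, c_0 = N is a unit and c_N =
    -p^h. *)
Theorem stickelberger r : (r <= N)%N -> vex w z pi (digsum p r) (c r).
Proof.
move=> rN; have [->|r0] := posnP r.
  rewrite digsum0 tcoef0; apply: vex0; first exact: red_nat.
  exact: (prim_order_natr_neq0 p_pr pF zP).
have compl : (digsum p r + digsum p (N - r) = h * p.-1)%N.
  have := digsum_compl p_gt1 (j := h) (a := r); rewrite cardN ltnS; exact.
have [rN'|rN'] := eqVneq r N.
  move: compl; rewrite rN' subnn digsum0 addn0 => ->.
  rewrite tcoef_last -mulN1r -[(h * _)%N]add0n; apply: vexM; last exact: vex_card.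
  apply: (vex0 pi (redN (red1 w z))).
  by rewrite oppr_eq0 oner_neq0.
have rlt : (r < N)%N by lia.
rewrite tcoef_gsum ?r0 //.
have [|t ht le] := @gsum_val_le r; first lia.
have [|t' ht' le'] := @gsum_val_le (N - r); first lia.
have [t1 [t2 [h1 h2 e]]] := vex_gsum_compl (a := (N - r)%N) (b := r)
  ltac:(lia) r0 ltac:(lia).
rewrite subKn // in ht'.
have a1 := vex_max wd pi0 hpi ht (vex_vge h1).
have a2 := vex_max wd pi0 hpi ht' (vex_vge h2).
by have <- : t = digsum p r by lia.
Qed.

End Stickelberger.

(** * Trace codes *)

(** Here [None] stands for infinity. *)
Definition leo (t : nat) (o : option nat) : bool :=
  if o is Some u then (t <= u)%N else true.

Lemma leo_inj o o' : (forall t, leo t o = leo t o') -> o = o'.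
Proof.
case: o o' => [u|] [u'|] //= H.
- by congr Some; apply/eqP; rewrite eqn_leq H leqnn -H leqnn.
- by have := H u.+1; rewrite ltnn.
- by have := H u'.+1; rewrite ltnn.
Qed.

(** The minimum of the statement is taken in [rat]; for natural values it is again natural or
    infinite, and lower bounds describe it without choosing a minimizer. *)
Lemma big_ominP (I : Type) (s : seq I) (P : pred I) (V : I -> option nat) :
  exists2 o, \big[omin/None]_(i <- s | P i) omap (fun t : nat => t%:R : rat) (V i) =
    omap (fun t : nat => t%:R) o &
    forall t, leo t o = all (fun i => P i ==> leo t (V i)) s.
Proof.
elim: s => [|i s [o IH1 IH2]]; first by exists None; rewrite ?big_nil.
rewrite big_cons; case Pi: (P i); last first.
  by exists o => //= t; rewrite ?Pi IH2.
rewrite IH1 /=; case EV: (V i) => [v|].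
  case: o IH1 IH2 => [u|] /= IH1 IH2; last first.
    by exists (Some v) => // t /=; rewrite ?Pi -IH2 ?EV andbT.
  exists (Some (minn v u)) => [|t] /=; last by rewrite ?Pi leq_min -IH2 ?EV.
  by rewrite natr_min.
exists o; first by case: o {IH1 IH2}.
by move=> t /=; rewrite ?Pi ?EV -IH2.
Qed.

(** Supplies the witness that [epsilon] requires in [trcode_pval] and [nu]. *)
Lemma last_true (P : nat -> Prop) : P 0%N ->
  (exists t, P t /\ ~ P t.+1) \/ (forall t, P t).
Proof.
move=> P0; case: (classic (exists t, P t /\ ~ P t.+1)) => [|no]; [by left|right].
elim=> // t IH; case: (classic (P t.+1)) => // nP; case: no; by exists t.
Qed.

Lemma trcode_pvalP (F : finFieldType) k n p q m (G : 'M[F]_(k, n)) t :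
  trcode_divisible q m G (p ^ t) <-> leo t (trcode_pval p q m G).
Proof.
have H : trcode_pval_is p q m G (trcode_pval p q m G).
  apply: epsilon_spec.
  have [|[u hu]|hu] := @last_true (fun t => trcode_divisible q m G (p ^ t)).
  - by move=> u; rewrite expn0 dvd1n.
  - by exists (Some u).
  - by exists None.
have mono a b : (a <= b)%N -> trcode_divisible q m G (p ^ b) ->
    trcode_divisible q m G (p ^ a).
  by move=> ab h u; apply: dvdn_trans (h u); exact: dvdn_exp2l.
case: (trcode_pval p q m G) H => [u [h1 h2]|h]; last by split.
split=> [ht|tu]; last exact: mono h1.
by rewrite /= leqNgt; apply/negP => ut; apply: h2; exact: mono ht.
Qed.

(** * From p-adic valuations in Z[xi] to pi-adic ones in Z[w] *)

Section Nu.
Variables (p N : nat) (F : finFieldType) (z : F) (xi zeta : algC).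
Hypotheses (p_pr : prime p) (pF : p \in [pchar F]) (zP : N.-primitive_root z).
Hypotheses (xiP : N.-primitive_root xi) (zetaP : p.-primitive_root zeta).

Lemma nu_geP t a : nu_ge p z xi t a <-> vge xi z p%:R t a.
Proof.
split=> [[s [b [s0 e]]]|[s [b [y [y' [[f [-> ef]] y0 [g [-> eg]] e]]]]]].
  exists (intpC s).[xi], (intpC b).[xi], (intpF F s).[z], (intpF F b).[z].
  by split=> //; [exists s|exists b|rewrite e natrX].
by exists f, g; rewrite -ef natrX.
Qed.

(** When the value t is finite, the cofactor of p^t has nonzero reduction, for otherwise
    [unramified] would yield one more factor p. Passing from p to pi multiplies the value by p -
    1. *)
Lemma nu_vex a : integral xi z a ->
  if nu p z xi a is Some t then vex (zeta * xi) z (1 - zeta) (p.-1 * t) a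
  else forall t, vge (zeta * xi) z (1 - zeta) t a.
Proof.
move=> ia.
have H : nu_is p z xi a (nu p z xi a).
  apply: epsilon_spec.
  have [|[u hu]|hu] := @last_true (fun t => nu_ge p z xi t a).
  - by apply/nu_geP; exact: vge_integral.
  - by exists (Some u).
  - by exists None.
have vp := vex_p p_pr pF zP xiP zetaP.
case: (nu p z xi a) H => [t [/nu_geP h1 h2]|h].
  apply: vex_trans vp _; apply: (vex_omega p_pr pF zP xiP zetaP).
  have [s [b [y [y' [hs y0 hb e]]]]] := h1.
  have [y'0|y'0] := eqVneq y' 0; last by exists s, b, y, y'.
  case: h2; apply/nu_geP.
  rewrite y'0 in hb.
  have [s1 [b1 [y1 [y1' [hs1 y10 hb1 e1]]]]] := unramified p_pr pF zP xiP hb.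
  exists (s1 * s), b1, (y1 * y), y1'; split=> //; [exact: redM|by rewrite mulf_neq0|].
  by rewrite -mulrA e mulrCA e1 expr1 exprSr mulrA.
move=> t; have le : (t <= p.-1 * t)%N.
  by rewrite leq_pmull //; have := prime_gt1 p_pr; lia.
apply: (vge_leq (red_omega_pi p_pr pF zP xiP zetaP) le).
apply: vge_trans (vex_vge vp) _; apply: (vge_omega p_pr pF zP xiP zetaP).
exact/nu_geP.
Qed.

End Nu.

(** * Weights of the trace code and the minimum formula *)

Section TraceCode.
Variables (p e m N k n : nat) (F : finFieldType) (z : F) (xi zeta : algC).
Variable G : 'M[F]_(k, n).
Hypotheses (p_pr : prime p) (e_gt0 : (0 < e)%N) (m_gt0 : (0 < m)%N).
Hypotheses (cardF : #|F| = (p ^ (e * m))%N) (cardN : (p ^ (e * m))%N = N.+1).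
Hypotheses (zP : N.-primitive_root z) (xiP : N.-primitive_root xi).
Hypotheses (zetaP : p.-primitive_root zeta).

Let pF : p \in [pchar F] := card_finPcharP cardF p_pr.
Let cardFN : #|F| = N.+1. Proof. by rewrite cardF. Qed.
Let zP' : ((p ^ (e * m)).-1).-primitive_root z. Proof. by rewrite cardN. Qed.
Let em_gt0 : (0 < e * m)%N. Proof. by rewrite muln_gt0 e_gt0. Qed.
Let q := (p ^ e)%N.
Let q_gt1 : (1 < q)%N.
Proof. by rewrite -(exp1n e) ltn_exp2r // prime_gt1. Qed.

Local Notation T := (tlift N z xi).
Local Notation psi := (achar p (e * m) zeta).
Let w := zeta * xi.
Let pi := 1 - zeta.
Local Notation c := (tcoef N z xi (achar p (e * m) zeta)).
Let TM x y : T (x * y) = T x * T y := tliftM cardFN zP xiP x y.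

Lemma subfield_neq0 (b : F) : (b ^+ q.-1 == 1) = (b ^+ q == b) && (b != 0).
Proof.
have [->|b0] := eqVneq b 0.
  have q0 : (q.-1 == 0)%N = false by apply/eqP; lia.
  by rewrite andbF expr0n q0 eq_sym oner_eq0.
rewrite andbT -[X in _ = (_ ^+ X == _)](prednK (ltnW q_gt1)) exprS.
rewrite -[X in _ = (_ == X)]mulr1.
by rewrite (inj_eq (mulfI b0)).
Qed.

(** Origin of the congruence modulo q - 1: summing over the nonzero elements of F_q kills all other
    exponents. *)
Lemma sum_tlift_subfield s :
  \sum_(b | b ^+ q.-1 == 1) T b ^+ s = if (q.-1 %| s)%N then (q.-1)%:R else 0.
Proof.
have dv : (q.-1 %| N)%N by rewrite -[N]/(N.+1.-1) -cardN expnM dvdn_pred_predX.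
rewrite (sum_unity_roots _ (dvdn_prim_root zP dv)).
rewrite -(sum_prim_root_pow s (dvdn_prim_root xiP dv)); apply: eq_bigr => i _.
by rewrite -[(z ^+ _) ^+ _]exprM (tliftX zP xiP) exprM exprAC.
Qed.

Definition msum (r : {ffun 'I_k -> 'I_N.+1}) : algC :=
  \sum_(j < n) \prod_(i < k) T (G i j) ^+ r i.

Definition admissible (r : {ffun 'I_k -> 'I_N.+1}) : bool :=
  (q.-1 %| \sum_(i < k) r i)%N && (0 < \sum_(i < k) r i)%N.

Definition wcoef (r : {ffun 'I_k -> 'I_N.+1}) : algC :=
  (\prod_i c (r i)) * msum r.

Definition weight (u : {ffun 'I_k -> F}) : nat := tr_weight q m (\row_i u i *m G).

(** By orthogonality over F_q without its term b = 0, a coordinate contributes q - 1 if its trace is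
    0 and -1 otherwise. *)
Lemma weight_achar (u : {ffun 'I_k -> F}) :
  \sum_(b | b ^+ q.-1 == 1) \sum_(j < n) psi (b * \sum_i u i * G i j) =
  (q.-1)%:R * n%:R - q%:R * (weight u)%:R.
Proof.
rewrite exchange_big /=.
have e1 j : \sum_(b | b ^+ q.-1 == 1) psi (b * \sum_i u i * G i j) =
    (q.-1)%:R - q%:R * (trace q m ((\row_i u i *m G) 0 j) != 0)%:R.
  have -> : (\row_i u i *m G) 0 j = \sum_i u i * G i j.
    by rewrite mxE; apply: eq_bigr => i _; rewrite mxE.
  set y := \sum_i _.
  have := achar_sum_subfield p_pr em_gt0 cardF zP' zetaP y e_gt0 (erefl _).
  rewrite (bigD1 0) /=; last by rewrite expr0n expn_eq0 (gtn_eqF (prime_gt0 p_pr)).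
  rewrite mul0r (achar0 p_pr cardF zetaP).
  rewrite (eq_bigl (fun b => b ^+ q.-1 == 1)) => [es|b]; last by rewrite subfield_neq0.
  apply: (addrI 1); rewrite es -/q addrA -(natrD _ 1) add1n prednK; last lia.
  by case: eqP => _ /=; rewrite ?mulr0 ?subr0 ?mulr1 ?subrr.
rewrite (eq_bigr _ (fun j _ => e1 j)) sumrB sumr_const card_ord mulr_natr; congr (_ - _).
rewrite -mulr_sumr -natr_sum /weight /tr_weight -sum1dep_card; congr (_ * _%:R).
by rewrite [RHS]big_mkcond /=; apply: eq_bigr => j _; case: (_ != 0).
Qed.

(** Each psi(b u_i g_ij) is expanded in Teichmueller powers and the product over i is distributed;
    the sum over b then selects the exponents. *)
Lemma weight_expansion (u : {ffun 'I_k -> F}) :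
  - (N%:R ^+ k * (q%:R * (weight u)%:R)) =
  (q.-1)%:R * \sum_r (if admissible r then wcoef r else 0) * \prod_i T (u i) ^+ r i.
Proof.
have psiE b j : N%:R ^+ k * psi (b * \sum_i u i * G i j) =
    \sum_(r : {ffun 'I_k -> 'I_N.+1}) T b ^+ (\sum_(i < k) r i) *
      ((\prod_i c (r i)) * (\prod_i T (u i) ^+ r i) * \prod_i T (G i j) ^+ r i).
  rewrite mulr_sumr (achar_sum p_pr cardF zetaP).
  rewrite -[X in _ ^+ X](card_ord k) -prodr_const -big_split /=.
  under eq_bigr do rewrite (tcoef_expand cardFN zP xiP).
  rewrite bigA_distr_bigA; apply: eq_bigr => r _.
  rewrite expr_sum -!big_split; apply: eq_bigr => i _ /=.
  by rewrite !TM !exprMn mulrCA !mulrA; ring.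
have tot : N%:R ^+ k * ((q.-1)%:R * n%:R - q%:R * (weight u)%:R) =
    (q.-1)%:R * \sum_(r : {ffun 'I_k -> 'I_N.+1} | (q.-1 %| \sum_(i < k) r i)%N)
      wcoef r * \prod_i T (u i) ^+ r i.
  rewrite -weight_achar mulr_sumr.
  transitivity (\sum_(b : F | b ^+ q.-1 == 1) \sum_(r : {ffun 'I_k -> 'I_N.+1})
      T b ^+ (\sum_(i < k) r i) * (wcoef r * \prod_i T (u i) ^+ r i)).
    apply: eq_bigr => b _; rewrite mulr_sumr.
    under eq_bigr do rewrite psiE.
    rewrite exchange_big; apply: eq_bigr => r _ /=.
    by rewrite -mulr_sumr -mulr_sumr /wcoef /msum; congr (_ * _); rewrite mulrAC.
  rewrite exchange_big /= mulr_sumr [RHS]big_mkcond; apply: eq_bigr => r _ /=.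
  by rewrite -mulr_suml sum_tlift_subfield; case: ifP => _; rewrite ?mul0r.
(* The zero exponent contributes N^k n, as c_0 = N and T(0)^0 = 1, and cancels the constant term of
   [weight_achar]; hence the condition |r| > 0. *)
pose r0 : {ffun 'I_k -> 'I_N.+1} := [ffun=> ord0].
have sr0 : (\sum_(i < k) r0 i = 0)%N by rewrite big1 // => i _; rewrite ffunE.
rewrite (bigD1 r0) /= ?sr0 ?dvdn0 // in tot.
have w0 : wcoef r0 * \prod_i T (u i) ^+ r0 i = N%:R ^+ k * n%:R.
  rewrite /wcoef /msum.
  rewrite (eq_bigr (fun=> N%:R)) => [|i _]; last first.
    by rewrite ffunE (tcoef0 _ _ _ p_pr cardF zetaP).
  rewrite prodr_const card_ord [X in _ * X]big1 => [|i _]; last by rewrite ffunE expr0.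
  rewrite mulr1 (eq_bigr (fun=> 1)) => [|j _]; last first.
    by rewrite big1 // => i _; rewrite ffunE expr0.
  by rewrite sumr_const card_ord.
rewrite w0 mulrBr mulrDr in tot.
rewrite [N%:R ^+ k * (_ * n%:R)]mulrCA in tot.
move/addrI: tot => ->; congr (_ * _).
rewrite big_mkcond [RHS](eq_bigr (fun r => if admissible r then
  wcoef r * \prod_i T (u i) ^+ r i else 0)) => [|r _]; last by case: ifP; rewrite ?mul0r.
apply: eq_bigr => r _; rewrite /admissible lt0n sum_nat_eq0.
congr (if _ then _ else _); congr (_ && ~~ _).
apply/eqP/forallP => [-> i|H]; first by rewrite ffunE.
by apply/ffunP => i; rewrite ffunE; apply: val_inj; apply/eqP; exact: (H i).
Qed.

Let wd := @omega_wd p N F z xi zeta p_pr pF zP xiP zetaP.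
Let pi0 : pi != 0 := pi_neq0 p_pr zetaP.
Let hpi : red w z pi 0 := red_omega_pi p_pr pF zP xiP zetaP.
Let vp : vex w z pi p.-1 p%:R := vex_p p_pr pF zP xiP zetaP.

(** The part of a prime to p has nonzero reduction, so the pi-adic valuation of a nonzero integer is
    p - 1 times its p-adic one. *)
Lemma vge_nat t a : (p ^ t %| a)%N <-> vge w z pi (p.-1 * t) a%:R.
Proof.
split=> [/dvdnP [b ->]|h].
  rewrite natrM mulrC natrX -[(p.-1 * t)%N]addn0; apply: vgeM.
    by apply: vex_vge; exact: vexX.
  by apply: vge_integral; exists b%:R; exact: red_nat.
have [->|a0] := posnP a; first exact: dvdn0.
have [b bp ea] := pfactor_coprime p_pr a0.
have vb : vex w z pi (p.-1 * logn p a + 0) a%:R.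
  rewrite [in X in vex _ _ _ _ X]ea natrM mulrC natrX; apply: vexM; first exact: vexX.
  apply: (vex0 pi (red_nat w z b)).
  by rewrite -(dvdn_pcharf pF) -prime_coprime.
have := vex_max wd pi0 hpi vb h.
rewrite addn0 leq_pmul2l; last by have := prime_gt1 p_pr; lia.
by rewrite -pfactor_dvdn.
Qed.

Lemma vex_unit : vex w z pi 0 ((q.-1)%:R * N%:R ^+ k).
Proof.
apply: (@vex0 _ _ _ _ _ ((q.-1)%:R * N%:R ^+ k)).
  by apply: redM; [exact: red_nat|apply: redX; exact: red_nat].
rewrite mulf_neq0 ?expf_neq0 ?(prim_order_natr_neq0 p_pr pF zP) //.
rewrite -(dvdn_pcharf pF) -prime_coprime // -(coprime_pexpl _ _ e_gt0) -/q.
by rewrite coprimenP; lia.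
Qed.

(** Up to units, the coefficients are integral combinations of the numbers q wt(u), by
    [interp_multi], and conversely, by [weight_expansion]. The shift by e is the valuation of q. *)
Lemma trcode_divisible_vge t :
  trcode_divisible q m G (p ^ t) <->
  (forall r, admissible r -> vge w z pi (p.-1 * (e + t)) (wcoef r)).
Proof.
have vq : vex w z pi (p.-1 * e) q%:R by rewrite natrX; exact: vexX.
have it (x : F) s : integral w z (T x ^+ s).
  exists (x ^+ s); apply: redX; exact: (red_omega_tlift p_pr cardF cardN zP xiP zetaP).
split=> [H r ar|H u].
  pose a s := if admissible s then wcoef s else 0.
  suff : vge w z pi (0 + p.-1 * (e + t)) (((q.-1)%:R * N%:R ^+ k) * a r).
    by rewrite /a ar; apply: vge_cancel => //; exact: vex_unit.
  rewrite add0n -mulrA -(interp_multi cardFN zP xiP a r) mulr_sumr.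
  apply: vge_sum => u _; rewrite mulrCA -weight_expansion mulrN -mulNr mulrCA mulrA.
  rewrite -[(p.-1 * _)%N]add0n; apply: vgeM.
    apply: vge_integral; apply: integralM.
      by exists (N%:R ^+ k); apply: redX; exact: red_nat.
    have [y hy] : integral w z (\prod_i interp N z xi (u i) (r i)).
      apply: integral_prod => i _.
      have [y hy] := integral_interp cardFN zP xiP (u i) (r i).
      by exists y; exact: (red_omega p_pr pF zP xiP zetaP).
    by exists (- y); exact: redN.
  rewrite mulnDr; apply: vgeM; first exact: vex_vge.
  by apply/vge_nat; exact: H.
apply/vge_nat.
pose uf : {ffun 'I_k -> F} := [ffun i => u 0 i].
have -> : tr_weight q m (u *m G) = weight uf.
  rewrite /weight; congr (tr_weight _ _ (_ *m _)); apply/rowP => i.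
  by rewrite mxE ffunE.
suff h : vge w z pi (p.-1 * e + p.-1 * t) (q%:R * (weight uf)%:R).
  exact: (vge_cancel pi0 vq h).
rewrite -mulnDr.
have vN : vex w z pi 0 (- (N%:R ^+ k)).
  apply: (@vex0 _ _ _ _ _ (- (N%:R ^+ k))).
    by apply: redN; apply: redX; exact: red_nat.
  by rewrite oppr_eq0 expf_neq0 // (prim_order_natr_neq0 p_pr pF zP).
suff h : vge w z pi (0 + p.-1 * (e + t)) (- (N%:R ^+ k) * (q%:R * (weight uf)%:R)).
  exact: (vge_cancel pi0 vN h).
rewrite mulNr weight_expansion; apply: vgeM.
  by apply: vge_integral; exists (q.-1)%:R; exact: red_nat.
apply: vge_sum => r _; rewrite -[(p.-1 * _)%N]addn0; apply: vgeM.
  by case: ifP => [/H|_] //; exact: vge_zero.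
by apply: vge_integral; apply: integral_prod => i _; exact: it.
Qed.

Lemma vex_prod_tcoef (r : {ffun 'I_k -> 'I_N.+1}) :
  vex w z pi (\sum_(i < k) digsum p (r i)) (\prod_i c (r i)).
Proof.
apply: vex_prod => i _.
apply: (stickelberger p_pr em_gt0 cardF cardN zP xiP zetaP).
by rewrite -ltnS.
Qed.

(** An integer is congruent to its digit sum modulo p - 1, which divides q - 1; so the first term of
    the formula is an integer. *)
Lemma admissible_digsum (r : {ffun 'I_k -> 'I_N.+1}) : admissible r ->
  (p.-1 %| \sum_(i < k) digsum p (r i))%N.
Proof.
move=> /andP [dv _].
have dv' := dvdn_trans (dvdn_pred_predX p e) dv.
have [d ed] : exists d, (\sum_(i < k) r i = \sum_(i < k) digsum p (r i) + d * p.-1)%N.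
  elim/big_ind2: _ => [|a b a' b' [x ->] [y ->]|i _]; first by exists 0%N.
    by exists (x + y)%N; rewrite mulnDl; lia.
  exact: digsum_mod (prime_gt1 p_pr) _.
by move: dv'; rewrite ed dvdn_addl // dvdn_mull.
Qed.

(** The quantity to be minimized before e is subtracted; the quotient is exact for admissible r. *)
Definition rvalue (r : {ffun 'I_k -> 'I_N.+1}) : option nat :=
  omap (fun v => ((\sum_(i < k) digsum p (r i)) %/ p.-1 + v)%N) (nu p z xi (msum r)).

Lemma vge_wcoef r t : admissible r ->
  vge w z pi (p.-1 * t) (wcoef r) <-> leo t (rvalue r).
Proof.
move=> ar; have p1 : (0 < p.-1)%N by have := prime_gt1 p_pr; lia.
have iM : integral xi z (msum r).
  apply: integral_sum => j _; apply: integral_prod => i _.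
  by exists (G i j ^+ r i); apply: redX; exact: (red_tlift cardFN zP xiP).
have := nu_vex p_pr pF zP xiP zetaP iM.
have vS := vex_prod_tcoef r; have /dvdnP [s es] := admissible_digsum ar.
rewrite /rvalue es; case: (nu p z xi (msum r)) => [v|] /= H.
  rewrite mulnK //; have vW := vexM vS H; rewrite es mulnC -mulnDr in vW.
  split=> [h|le].
    by have := vex_max wd pi0 hpi vW h; rewrite leq_pmul2l.
  by apply: vge_leq hpi _ (vex_vge vW); rewrite leq_pmul2l.
split=> // _; rewrite -[(p.-1 * t)%N]add0n; apply: vgeM (H _).
by apply: vge_leq hpi _ (vex_vge vS).
Qed.

Lemma trcode_pval_big :
  omap (fun t : nat => t%:R : rat) (trcode_pval p q m G) =
  \big[omin/None]_(r | admissible r)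
     omap (fun v : nat =>
             (\sum_(i < k) (digsum p (r i))%:R) / (p.-1)%:R + v%:R - e%:R : rat)
       (nu p z xi (msum r)).
Proof.
have key t : trcode_divisible q m G (p ^ t) <->
    (forall r, admissible r -> leo (e + t) (rvalue r)).
  rewrite trcode_divisible_vge; split=> H r ar; apply/(vge_wcoef _ ar); exact: H.
(* The case t = 0 of [key]: divisibility by 1 always holds, so the natural subtraction of e does not
   truncate. *)
have ge_e r : admissible r -> leo e (rvalue r).
  rewrite -{1}[e]addn0; move: r; apply/key => u; exact: dvd1n.
pose V r := omap (fun v => (v - e)%N) (rvalue r).
rewrite (eq_bigr (fun r => omap (fun t : nat => t%:R : rat) (V r))) => [|r ar].
  have [o -> oP] := big_ominP (index_enum {ffun 'I_k -> 'I_N.+1}) admissible V.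
  congr omap; apply: leo_inj => t; rewrite oP.
  have leV r : admissible r -> leo t (V r) = leo (e + t) (rvalue r).
    move=> /ge_e; rewrite /V; case: (rvalue r) => //= v ev; lia.
  apply/idP/allP => [/trcode_pvalP/key H r _|H].
    by apply/implyP => ar; rewrite leV // H.
  apply/trcode_pvalP/key => r ar; rewrite -leV //.
  by have := H r (mem_index_enum r); rewrite ar.
have := ge_e r ar; have /dvdnP [s es] := admissible_digsum ar.
have p1 : (0 < p.-1)%N by have := prime_gt1 p_pr; lia.
rewrite /V /rvalue; case: (nu _ _ _ _) => //= v; rewrite es mulnK // => le.
rewrite -natr_sum es natrM mulfK; last by rewrite pnatr_eq0; lia.
by rewrite natrB // natrD.
Qed.

End TraceCode.

Theorem theorem3p2 (p e m k n : nat) (F : finFieldType) (G : 'M[F]_(k, n))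
    (xi : algC) (z : F) :
  prime p -> (0 < e)%N -> (0 < m)%N ->
  #|F| = ((p ^ e) ^ m)%N ->
  \rank G = k ->
  ((p ^ e) ^ m).-1.-primitive_root xi ->
  ((p ^ e) ^ m).-1.-primitive_root z ->
  omap (fun t : nat => t%:R : rat) (trcode_pval p (p ^ e) m G) =
  \big[omin/None]_(r : {ffun 'I_k -> 'I_((p ^ e) ^ m)} |
                     (((p ^ e).-1 %| \sum_(i < k) r i)%N && (0 < \sum_(i < k) r i)%N))
     omap (fun w : nat =>
             (\sum_(i < k) (digsum p (r i))%:R) / (p.-1)%:R + w%:R - e%:R : rat)
       (nu p z xi
          (\sum_(j < n) \prod_(i < k)
              tlift ((p ^ e) ^ m).-1 z xi (G i j) ^+ (r i))).
Proof.
move=> p_pr e0 m0 cF _ xiP zP.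
have [zeta zetaP] := C_prim_root_exists (prime_gt0 p_pr).
have Q0 : (0 < (p ^ e) ^ m)%N by rewrite !expn_gt0 prime_gt0.
rewrite -expnM in cF.
have cN : (p ^ (e * m))%N = ((p ^ e) ^ m).-1.+1 by rewrite prednK // expnM.
have := trcode_pval_big G p_pr e0 m0 cF cN zP xiP zetaP.
rewrite /admissible /msum => ->.
(* Once q^m is a successor, the index types ['I_((p ^ e) ^ m)] and ['I_((p ^ e) ^ m).-1.+1] are
   convertible. *)
by case: ((p ^ e) ^ m)%N Q0.
Qed.
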